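(* Suppose $f$ is meromorphic on $D = D^{+}(a,R)\subset\mathbb{C}_p$ and that all zeros and poles of $f$ can be found in the open discs $D_{i} = D^{-}(z_{i},R)$ for $i = 1,\dots,M$. Let $b$ be on the circle $|x - a|_{p} = R$, but not in any $D_{i}$. Let $Z_{i}$ be the number of zeros and $P_{i}$ the number of poles of $f$ in $D_{i}$, counting multiplicity. Let $\alpha \in \mathbb{Z}_{\geq 0}$. Then $$\int_{\mathcal{A}(a,b),\Phi_{\alpha}}\frac{f'(x)}{f(x)}\,dx = \sum_{i = 1}^{M}\frac{1}{1 - \omega^{p^{\alpha}}\left( \frac{a - z_{i}}{a - b}\right)}\left(Z_{i} - P_{i}\right).$$
   Context: $p$ is an odd prime; $\mathbb{C}_p$ is the completion of an algebraic closure of $\mathbb{Q}_p$, with $|p|_p=1/p$. $D^+(c,r)$ and $D^-(c,r)$ are the closed and open discs with center $c$ and radius $r$. $H(D)$ is the set of functions on $D$ given by a single power series convergent on $D$; a meromorphic function on the closed disc $D$ is a quotient of two elements of $H(D)$ whose denominator is not identically zero. Arc: for $a\ne b$ in $\mathbb{C}_p$ with $R=|a-b|_p$, the arc $\mathcal{A}(a,b)$ is the open disc $\{x : |x-b|_p<R\}$. Path sequence: a function $\varphi$ defined for all integers $k\ge k_0$ (some $k_0\in\mathbb{Z}^+$), with values in $\mathbb{Z}^+$ and strictly increasing. For $f:\mathcal{A}(a,b)\to\mathbb{C}_p$ put $A_{f,\varphi}(k)=p^{-\varphi(k)}\sum_{\zeta}(x-a)f(x)$, where $x=a+(b-a)\zeta$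 and $\zeta$ runs through the $p^{\varphi(k)}$-th roots of unity. A non-empty family $\Phi$ of path sequences is interlocked if for all $\varphi_1,\varphi_2\in\Phi$ there are $\varphi_3\in\Phi$ and $k_0$ such that $\varphi_3(k)$, $k\ge k_0$, is a subsequence of both $\varphi_1$ and $\varphi_2$. For interlocked $\Phi$, $\int_{\mathcal{A}(a,b),\Phi}f(x)\,dx=L$ means: for every $\varepsilon>0$ there are $\varphi_\varepsilon\in\Phi$ and $K_\varepsilon$ with $|A_{f,\varphi_\varepsilon}(k)-L|_p<\varepsilon$ for all $k>K_\varepsilon$ (such $L$ is unique if it exists). For $\alpha\in\mathbb{Z}$, $\Phi_\alpha$ is the interlocked family $\{\varphi : \varphi(k)=\alpha+\lambda k,\ \lambda=1,2,\dots\}$. $\omega$ is the Teichmüller character: for $|x|_p=1$, $\omega(x)$ is the unique root of unity of order prime to $p$ with $|x-\omega(x)|_p<1$; $\omega(x)=0$ if $|x|_p<1$. $\omega^{p^\alpha}(x)$ means $\omega(x)^{p^\alpha}$. *)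

(* Defs.v *)
From mathcomp Require Import all_boot all_order all_algebra.
From mathcomp Require Import all_classical all_reals all_analysis.
From mathcomp Require Import zify.

Set Implicit Arguments.
Unset Strict Implicit.
Unset Printing Implicit Defensive.

Import Order.TTheory GRing.Theory Num.Theory.
Import numFieldNormedType.Exports.

Local Open Scope classical_set_scope.
Local Open Scope ring_scope.

(* MathComp's norm classes require |x *+ n| = |x| *+ n, which no
   non-archimedean absolute value satisfies; hence the bare function
   v : K -> R below. *)

Record ultrametric_absval (R : realType) (K : fieldType) (v : K -> R) : Prop := {
  absval_ge0 : forall x, 0 <= v x ;
  absval_eq0 : forall x, v x = 0 <-> x = 0 ;
  absvalM : forall x y, v (x * y) = v x * v y ;
  absval_ultra : forall x y, v (x + y) <= Num.max (v x) (v y) }.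

Section AbsoluteValue.
Context {R : realType} {K : fieldType} (v : K -> R).

Definition vcvg (u : nat -> K) (l : K) : Prop :=
  (fun n => v (u n - l)) @ \oo --> (0 : R).

Definition vcauchy (u : nat -> K) : Prop :=
  forall e : R, 0 < e ->
    exists N : nat, forall m n, (N <= m)%N -> (N <= n)%N -> v (u m - u n) < e.

(* Q_p inside K: the closure of the prime field, which is its completion
   when K is complete. *)
Definition Qp : set K :=
  [set x | exists q : nat -> rat, vcvg (fun n => ratr (q n)) x].

Definition Qpbar : set K :=
  [set x | exists P : {poly K},
     [/\ P \is monic, forall i, Qp P`_i & root P x]].

End AbsoluteValue.

(* (K, v) is the completion of an algebraic closure of Q_p, with |p| = 1/p.
   This determines (K, v) up to isometric isomorphism. *)
Record is_Cp (R : realType) (p : nat) (K : fieldType) (v : K -> R) : Prop := {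
  Cp_absval : ultrametric_absval v ;
  Cp_p : v p%:R = p%:R^-1 ;
  Cp_complete : forall u, vcauchy v u -> exists l, vcvg v u l ;
  Cp_Qpbar_closed : forall P : {poly K},
    (forall i, Qpbar v P`_i) -> (1 < size P)%N ->
    exists x, Qpbar v x /\ root P x ;
  Cp_Qpbar_dense : forall x (e : R), 0 < e ->
    exists y, Qpbar v y /\ v (x - y) < e }.

Section Functions.
Context {R : realType} {K : fieldType} (v : K -> R).

Definition cdisc (c : K) (r : R) : set K := [set x | v (x - c) <= r].
Definition odisc (c : K) (r : R) : set K := [set x | v (x - c) < r].

(* H(D) for D = D^+(c, r); only the values of h on D matter. *)
Definition HD (c : K) (r : R) (h : K -> K) : Prop :=
  exists s : nat -> K, forall x, cdisc c r x ->
    vcvg v (fun n => \sum_(i < n) s i * (x - c) ^+ i) (h x).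

(* f y -> l as y -> x with y <> x *)
Definition tends_to (f : K -> K) (x l : K) : Prop :=
  forall e : R, 0 < e -> exists2 d : R, 0 < d &
    forall y, 0 < v (y - x) < d -> v (f y - l) < e.

(* The last clause fixes the value of f = g / h at the zeros of h where the
   singularity is removable.  At a pole the value of f is arbitrary. *)
Definition meromorphic_on (c : K) (r : R) (f : K -> K) : Prop :=
  exists g h : K -> K,
    [/\ HD c r g, HD c r h, (exists2 x, cdisc c r x & h x <> 0),
        (forall x, cdisc c r x -> h x <> 0 -> f x = g x / h x)
      & (forall x l, cdisc c r x -> tends_to f x l -> f x = l)].

(* f', with junk value 0 where f is not differentiable *)
Definition vderive (f : K -> K) (x : K) : K :=
  xget 0 [set d | tends_to (fun y => (f y - f x) / (y - x)) x d].

(* n is an exponent in int: near z, f(x) = (x - z)^n u(x) with u given by a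
   power series at z and u(z) <> 0. *)
Definition has_order (f : K -> K) (z : K) (n : int) : Prop :=
  exists (u : K -> K) (d : R),
    [/\ 0 < d, HD z d u, u z <> 0
      & forall x, cdisc z d x -> x <> z -> f x = (x - z) ^ n * u x].

(* junk value 0 if f has no order at z, e.g. if f vanishes near z *)
Definition order (f : K -> K) (z : K) : int := xget 0 [set n | has_order f z n].

Definition zero_mult (f : K -> K) (z : K) : nat :=
  if order f z is Posz n then n else 0%N.
Definition pole_mult (f : K -> K) (z : K) : nat :=
  if order f z is Negz n then n.+1 else 0%N.

Definition is_pole (f : K -> K) (z : K) : Prop :=
  exists2 n : int, n < 0 & has_order f z n.
Definition is_zero (f : K -> K) (z : K) : Prop := ~ is_pole f z /\ f z = 0.

Definition num_zeros (f : K -> K) (A : set K) : nat :=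
  \big[addn/0%N]_(z \in A) zero_mult f z.
Definition num_poles (f : K -> K) (A : set K) : nat :=
  \big[addn/0%N]_(z \in A) pole_mult f z.

(* The Teichmuller character; junk value 0 for |x| > 1. *)
Definition omega (p : nat) (x : K) : K :=
  if v x == 1 then
    xget 0 [set w | (exists2 m : nat, coprime m p & m.-primitive_root w)
                    /\ v (x - w) < 1]
  else 0.

End Functions.

(* ps_fun below ps_start is irrelevant. *)
Record path_seq := PathSeq {
  ps_start : nat ;
  ps_fun :> nat -> nat ;
  ps_start_gt0 : (0 < ps_start)%N ;
  ps_gt0 : forall k, (ps_start <= k)%N -> (0 < ps_fun k)%N ;
  ps_incr : forall k l, (ps_start <= k)%N -> (k < l)%N ->
    (ps_fun k < ps_fun l)%N }.

(* (phi(k))_{k >= k0} is a subsequence of psi *)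
Definition subsequence_from (k0 : nat) (phi psi : path_seq) : Prop :=
  exists s : nat -> nat,
    (forall k l, (k0 <= k)%N -> (k < l)%N -> (s k < s l)%N) /\
    (forall k, (k0 <= k)%N -> (ps_start psi <= s k)%N /\ phi k = psi (s k)).

Definition interlocked (Phi : set path_seq) : Prop :=
  Phi !=set0 /\
  forall phi1 phi2, Phi phi1 -> Phi phi2 ->
    exists phi3 (k0 : nat),
      [/\ Phi phi3, (ps_start phi3 <= k0)%N,
          subsequence_from k0 phi3 phi1 & subsequence_from k0 phi3 phi2].

Record interlocked_family := InterlockedFamily {
  family_set : set path_seq ;
  family_interlocked : interlocked family_set }.

Definition Phi_set (alpha : int) : set path_seq :=
  [set phi | exists2 lambda : nat, (0 < lambda)%N &
     forall k, (ps_start phi <= k)%N -> (phi k)%:Z = alpha + (lambda * k)%:Z].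

Section PhiInterlocked.
Variables (alpha : int) (lambda : nat) (lambda_gt0 : (0 < lambda)%N).

Let start := `|alpha|%N.+1.
Let phi (k : nat) := `|(alpha + (lambda * k)%:Z)%R|%N.

Fact Phi_elt_gt0 k : (start <= k)%N -> (0 < phi k)%N.
Proof. by rewrite /start /phi; nia. Qed.

Fact Phi_elt_incr k l : (start <= k)%N -> (k < l)%N -> (phi k < phi l)%N.
Proof. by rewrite /start /phi => ? ?; nia. Qed.

Definition Phi_elt : path_seq :=
  PathSeq (isT : (0 < start)%N) Phi_elt_gt0 Phi_elt_incr.

Fact Phi_eltP k : (ps_start Phi_elt <= k)%N ->
  (Phi_elt k)%:Z = alpha + (lambda * k)%:Z.
Proof. by rewrite /= /start /phi => ?; nia. Qed.

End PhiInterlocked.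

Fact Phi_interlocked (alpha : int) : interlocked (Phi_set alpha).
Proof.
split; first by exists (Phi_elt alpha (isT : (0 < 1)%N)); exists 1%N => // k; exact: Phi_eltP.
move=> phi1 phi2 [l1 l1_gt0 E1] [l2 l2_gt0 E2].
have l12_gt0 : (0 < l1 * l2)%N by rewrite muln_gt0 l1_gt0.
pose phi3 := Phi_elt alpha l12_gt0.
pose k0 := (ps_start phi3 + ps_start phi1 + ps_start phi2)%N.
exists phi3, k0; split.
- by exists (l1 * l2)%N => // k; exact: Phi_eltP.
- by rewrite /k0 -addnA leq_addr.
- exists (fun k => (l2 * k)%N); split=> [k l _ kl|k k0k]; first by rewrite ltn_pmul2l.
  have le1 : (ps_start phi1 <= l2 * k)%N by move: k0k; rewrite /k0; nia.
  have le3 : (ps_start phi3 <= k)%N by move: k0k; rewrite /k0; lia.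
  split=> //; apply/eqP; rewrite -eqz_nat; apply/eqP.
  by rewrite E1 // (Phi_eltP le3) mulnA.
- exists (fun k => (l1 * k)%N); split=> [k l _ kl|k k0k]; first by rewrite ltn_pmul2l.
  have le2 : (ps_start phi2 <= l1 * k)%N by move: k0k; rewrite /k0; nia.
  have le3 : (ps_start phi3 <= k)%N by move: k0k; rewrite /k0; lia.
  split=> //; apply/eqP; rewrite -eqz_nat; apply/eqP.
  by rewrite E2 // (Phi_eltP le3) mulnA (mulnC l2).
Qed.

Definition Phi (alpha : int) : interlocked_family :=
  InterlockedFamily (Phi_interlocked alpha).

Section Integral.
Context {R : realType} {K : fieldType} (v : K -> R).

(* Only the values of f on A(a, b) = D^-(b, |a - b|) are used: |zeta - 1| < 1
   for a root of unity zeta of p-power order. *)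
Definition arc_sum (p : nat) (a b : K) (f : K -> K) (phi : nat -> nat)
    (k : nat) : K :=
  (p ^ phi k)%:R^-1 *
  \sum_(zeta \in [set zeta : K | (p ^ phi k).-unity_root zeta])
    (let x := a + (b - a) * zeta in (x - a) * f x).

(* The integral of f over A(a, b) along F exists and equals L. *)
Definition is_arc_integral (p : nat) (a b : K) (F : interlocked_family)
    (f : K -> K) (L : K) : Prop :=
  forall e : R, 0 < e -> exists phi : path_seq, family_set F phi /\
    exists N : nat, forall k, (ps_start phi <= k)%N -> (N < k)%N ->
      v (arc_sum p a b f phi k - L) < e.

End Integral.

(* Main.v *)
(* By Weierstrass preparation on the closed disc, f is a constant times
   prod (x - rho) / prod (x - sigma) times u1 / u2, where the rho and sigma are the
   zeros and poles and each uj is 1 plus a power series of Gauss norm < 1.  Put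
   q = p^n and x = a + (b - a) zeta.
   - A factor x - rho contributes (1/q) sum_zeta zeta / (zeta - t) = 1 / (1 - t^q) with
     t = (rho - a) / (b - a).  If |t - w| < 1 and w = omega(t), then t^(p^n) - w^(p^n)
     tends to 0, and w^(p^(alpha + lambda k)) = w^(p^alpha) as soon as lambda is a
     multiple of a period of w under the p-power map.
   - u'/u is again a convergent power series sum c_m y^m in y = (x - a) / (b - a), and it
     contributes the sum of the c_m with q | m + 1, which tends to 0.
   The zeros needed for the preparation theorem are limits of roots of polynomials over
   the algebraic closure of Q_p, each chosen nearest to the preceding one.  The
   Teichmuller representative of y exists because y satisfies a primitive integral
   equation modulo p, so by the pigeonhole principle |y^m - 1| < 1 for some m prime to p,
   and y is then close to an m-th root of unity. *)

(* The factor 1/q has absolute value q, so estimating the summands one at a time cannot give a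
   limit. Each kind of factor is therefore evaluated exactly by orthogonality of the q-th roots of
   unity, which restores a factor q, before any absolute value is taken.

   The numbers 1 / (1 - t^q) converge because 1 - w^(p^alpha) has absolute value 1: b lies outside
   D_i, hence |1 - t| >= 1, and the p-power map is injective on residues, so a power of w of this
   kind cannot come near 1. A single lambda has to serve all discs at once, hence the product of the
   periods.

   The given quotient describes f only where its denominator is nonzero, and numerator and
   denominator may share zeros. The factored form is therefore taken after cancellation and compared
   with f on punctured neighbourhoods; its values at points other than poles then follow from the
   clause on removable singularities. That clause also excludes a zero numerator: f would vanish at
   b, which lies in no D_i. *)
From HB Require Import structures.
Require Import Defs.
From mathcomp Require Import all_boot all_order all_algebra.
From mathcomp Require Import all_classical all_reals all_analysis.
From mathcomp Require cyclic.
From mathcomp Require Import zify ring lra.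

Set Implicit Arguments.
Unset Strict Implicit.
Unset Printing Implicit Defensive.

Import Order.TTheory GRing.Theory Num.Theory.
Import numFieldNormedType.Exports.

Local Open Scope classical_set_scope.
Local Open Scope ring_scope.

(** * Ultrametric absolute values and infinite sums *)

Section AbsoluteValueTheory.
Context {R : realType} {K : fieldType} (v : K -> R).
Hypothesis vP : ultrametric_absval v.

Implicit Types (x y z : K) (c d u w : nat -> K) (e B : R).

Let v_ge0 := absval_ge0 vP.
Let vM := absvalM vP.

Lemma v0 : v 0 = 0.
Proof. exact/(absval_eq0 vP). Qed.

Lemma v_eq0 x : (v x == 0) = (x == 0).
Proof. by apply/eqP/eqP => /(absval_eq0 vP). Qed.

Lemma v_gt0 x : (0 < v x) = (x != 0).
Proof. by rewrite lt_def v_eq0 v_ge0 andbT. Qed.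

Lemma v1 : v 1 = 1.
Proof.
apply: (@mulIf _ (v 1)); first by rewrite v_eq0 oner_neq0.
by rewrite -vM !mul1r.
Qed.

Lemma vX x n : v (x ^+ n) = v x ^+ n.
Proof. by elim: n => [|n IH]; rewrite ?expr0 ?v1 // !exprS vM IH. Qed.

Lemma vV x : v x^-1 = (v x)^-1.
Proof.
have [->|x0] := eqVneq x 0; first by rewrite invr0 v0 invr0.
apply: (@mulfI _ (v x)); first by rewrite v_eq0.
by rewrite -vM !mulfV ?v1 // v_eq0.
Qed.

Lemma vN x : v (- x) = v x.
Proof.
suff vN1 : v (-1) = 1 by rewrite -mulN1r vM vN1 mul1r.
apply: (@pexpIrn _ 2) => //; rewrite ?nnegrE ?v_ge0 ?ler01 //.
by rewrite -vX sqrrN !expr1n v1.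
Qed.

Lemma vBC x y : v (x - y) = v (y - x).
Proof. by rewrite -vN opprB. Qed.

Lemma vD_le x y e : v x <= e -> v y <= e -> v (x + y) <= e.
Proof. by move=> xe ye; rewrite (le_trans (absval_ultra vP _ _))// ge_max xe. Qed.

Lemma vD_lt x y e : v x < e -> v y < e -> v (x + y) < e.
Proof. by move=> xe ye; rewrite (le_lt_trans (absval_ultra vP _ _))// gt_max xe. Qed.

Lemma vB_le x y e : v x <= e -> v y <= e -> v (x - y) <= e.
Proof. by move=> xe ye; rewrite vD_le ?vN. Qed.

Lemma vB_lt x y e : v x < e -> v y < e -> v (x - y) < e.
Proof. by move=> xe ye; rewrite vD_lt ?vN. Qed.

Lemma v_trans_le y x z e : v (x - y) <= e -> v (y - z) <= e -> v (x - z) <= e.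
Proof. by move=> xy yz; rewrite -(subrK y x) -addrA vD_le. Qed.

Lemma v_trans_lt y x z e : v (x - y) < e -> v (y - z) < e -> v (x - z) < e.
Proof. by move=> xy yz; rewrite -(subrK y x) -addrA vD_lt. Qed.

Lemma v_sum_le (I : Type) (r : seq I) (P : pred I) (F : I -> K) e : 0 <= e ->
  (forall i, P i -> v (F i) <= e) -> v (\sum_(i <- r | P i) F i) <= e.
Proof.
move=> e0 Fe; elim/big_rec: _ => [|i x Pi xe]; first by rewrite v0.
by rewrite vD_le// Fe.
Qed.

Lemma v_sum_lt (I : Type) (r : seq I) (P : pred I) (F : I -> K) e : 0 < e ->
  (forall i, P i -> v (F i) < e) -> v (\sum_(i <- r | P i) F i) < e.
Proof.
move=> e0 Fe; elim/big_rec: _ => [|i x Pi xe]; first by rewrite v0.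
by rewrite vD_lt// Fe.
Qed.

(** Isosceles principle: if x were smaller than y, then y = x - (x - y) would be smaller than
    itself. *)
Lemma v_dom x y : v (x - y) < v y -> v x = v y.
Proof.
move=> xy; apply/eqP; rewrite eq_le; apply/andP; split.
  by rewrite -(subrK y x) vD_le// ltW.
rewrite leNgt; apply/negP => xlt.
by have := vB_lt xlt xy; rewrite opprB addrC subrK ltxx.
Qed.

Lemma v_nat_le1 n : v n%:R <= 1.
Proof. by elim: n => [|n IH]; rewrite ?v0 // -natr1 vD_le ?v1. Qed.

Lemma v_int_le1 (m : int) : v m%:~R <= 1.
Proof. by case: m => n; rewrite ?NegzE ?mulrNz ?vN; exact: v_nat_le1. Qed.

Lemma v_expr_le1 x n : v x <= 1 -> v (x ^+ n) <= 1.
Proof. by move=> x1; rewrite vX exprn_ile1. Qed.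

Lemma v_mulr_le x y e : v x <= e -> v y <= 1 -> v (x * y) <= e.
Proof.
move=> xe y1; rewrite vM (le_trans _ xe)// -[leRHS]mulr1 ler_wpM2l ?v_ge0//.
Qed.

Lemma v_mulr_lt x y e : v x < e -> v y <= 1 -> v (x * y) < e.
Proof. by move=> xe y1; rewrite (le_lt_trans _ xe)// v_mulr_le. Qed.

Lemma vcvgP u l : vcvg v u l <->
  forall e, 0 < e -> exists N, forall n, (N <= n)%N -> v (u n - l) < e.
Proof.
split=> [H e e0|H].
  have /cvgr0Pnorm_lt/(_ e e0) [N _ NP] := H.
  by exists N => n Nn; have := NP n Nn; rewrite /= ger0_norm.
apply/cvgr0Pnorm_lt => e e0; have [N NP] := H e e0.
by exists N => // n Nn; rewrite /= ger0_norm// NP.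
Qed.

Lemma vcvg_cst l : vcvg v (fun=> l) l.
Proof. by apply/vcvgP => e e0; exists 0%N => n _; rewrite subrr v0. Qed.

Lemma vcvg_le u l m B : vcvg v u l -> (forall n, v (u n - m) <= B) -> v (l - m) <= B.
Proof.
move=> /vcvgP ul uB; apply/ler_addgt0Pr => e e0.
have [N /(_ N (leqnn N)) ulN] := ul _ e0.
have B0 : 0 <= B := le_trans (v_ge0 _) (uB N).
apply: (@v_trans_le (u N)); last by rewrite (le_trans (uB N))// lerDl ltW.
by rewrite vBC (le_trans (ltW ulN))// lerDr.
Qed.

Lemma vcvg_le0 u l B : vcvg v u l -> (forall n, v (u n) <= B) -> v l <= B.
Proof. by move=> ul uB; rewrite -(subr0 l) (vcvg_le ul)// => n; rewrite subr0. Qed.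

Lemma v_small_eq0 x : (forall e, 0 < e -> v x <= e) -> x = 0.
Proof.
move=> H; apply/eqP; rewrite -v_eq0 eq_le v_ge0 andbT.
by apply/ler_addgt0Pr => e e0; rewrite add0r H.
Qed.

Lemma vcvg_unique u l m : vcvg v u l -> vcvg v u m -> l = m.
Proof.
move=> /vcvgP ul /vcvgP um; apply/subr0_eq/v_small_eq0 => e e0.
have [N1 N1P] := ul _ e0; have [N2 N2P] := um _ e0.
apply: (@v_trans_le (u (maxn N1 N2))); rewrite ltW//.
  by rewrite vBC N1P// leq_maxl.
by rewrite N2P// leq_maxr.
Qed.

Lemma eq_vcvg u w l : u =1 w -> vcvg v u l -> vcvg v w l.
Proof. by move=> /funext ->. Qed.

Lemma vcvgD u w l m : vcvg v u l -> vcvg v w m ->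
  vcvg v (fun n => u n + w n) (l + m).
Proof.
move=> /vcvgP ul /vcvgP um; apply/vcvgP => e e0.
have [N1 N1P] := ul _ e0; have [N2 N2P] := um _ e0.
exists (maxn N1 N2) => n; rewrite geq_max => /andP[n1 n2].
by rewrite opprD addrACA vD_lt// (N1P, N2P).
Qed.

Lemma vcvgMl u l x : vcvg v u l -> vcvg v (fun n => x * u n) (x * l).
Proof.
move=> /vcvgP ul; apply/vcvgP => e e0.
have x0 : 0 < v x + 1 by rewrite ltr_wpDl// v_ge0.
have [N NP] := ul (e / (v x + 1)) (divr_gt0 e0 x0).
exists N => n /NP; rewrite ltr_pdivlMr// -mulrBr vM => h.
rewrite (le_lt_trans _ h)// mulrC ler_wpM2l ?v_ge0//.
by rewrite lerDl.
Qed.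

Lemma vcvgN u l : vcvg v u l -> vcvg v (fun n => - u n) (- l).
Proof.
by move=> /(vcvgMl (-1)); rewrite mulN1r; apply: eq_vcvg => n; rewrite mulN1r.
Qed.

Lemma vcvgB u w l m : vcvg v u l -> vcvg v w m ->
  vcvg v (fun n => u n - w n) (l - m).
Proof. by move=> ul /vcvgN; apply: vcvgD. Qed.

Lemma vcvg_shift u l : vcvg v (fun n => u n.+1) l <-> vcvg v u l.
Proof.
split=> /vcvgP ul; apply/vcvgP => e /ul[N NP].
  by exists N.+1 => -[//|n] Nn; exact: NP.
by exists N => n Nn; rewrite NP// leqW.
Qed.

(** Over a complete ultrametric field this is exactly summability, so for coefficients it expresses
    convergence on the closed unit disc. *)
Definition vnull (c : nat -> K) := vcvg v c 0.

Lemma vnullP c : vnull c <->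
  forall e, 0 < e -> exists N, forall n, (N <= n)%N -> v (c n) < e.
Proof.
rewrite /vnull vcvgP; split=> H e /H [N NP]; exists N => n /NP; by rewrite subr0.
Qed.

Lemma eq_vnull c d : c =1 d -> vnull c -> vnull d.
Proof. exact: eq_vcvg. Qed.

Lemma vnull_le c d B : (forall n, v (d n) <= B * v (c n)) -> vnull c -> vnull d.
Proof.
move=> dc /vnullP c0; apply/vnullP => e e0.
have B0 : 0 < `|B| + 1 by rewrite ltr_wpDl.
have [N NP] := c0 (e / (`|B| + 1)) (divr_gt0 e0 B0).
exists N => n /NP; rewrite ltr_pdivlMr// => h.
rewrite (le_lt_trans (dc n))// (le_lt_trans _ h)// mulrC ler_wpM2l ?v_ge0//.
by rewrite (le_trans (ler_norm B))// lerDl.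
Qed.

Lemma vnull_bounded c : vnull c -> exists2 B, 0 < B & forall n, v (c n) <= B.
Proof.
move=> /vnullP/(_ 1 ltr01)[N NP].
exists (1 + \sum_(i < N) v (c i)).
  by rewrite ltr_pwDl// sumr_ge0.
move=> n; have [Nn|nN] := leqP N n.
  by rewrite (le_trans (ltW (NP n Nn)))// lerDl sumr_ge0.
rewrite (bigD1 (Ordinal nN))//= addrCA lerDl addr_ge0//.
by rewrite sumr_ge0.
Qed.

Lemma vnullD c d : vnull c -> vnull d -> vnull (fun n => c n + d n).
Proof. by move=> /vcvgD cd /cd; rewrite /vnull addr0. Qed.

Lemma vnullMl x c : vnull c -> vnull (fun n => x * c n).
Proof. by move=> /(vcvgMl x); rewrite /vnull mulr0. Qed.

Lemma vnull_mulr c y : v y <= 1 -> vnull c -> vnull (fun n => c n * y ^+ n).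
Proof.
move=> y1; apply: (@vnull_le _ _ 1) => n; rewrite mul1r v_mulr_le// v_expr_le1//.
Qed.

Lemma vnull_shift c : vnull (fun n => c n.+1) <-> vnull c.
Proof. exact: vcvg_shift. Qed.

Lemma vnull_shiftn c k : vnull c -> vnull (fun n => c (k + n)%N).
Proof.
move=> /vnullP c0; apply/vnullP => e /c0[N NP]; exists N => n Nn.
by rewrite NP// (leq_trans Nn)// leq_addl.
Qed.

Lemma vnull_finite c N : (forall n, (N <= n)%N -> c n = 0) -> vnull c.
Proof. by move=> cN; apply/vnullP => e e0; exists N => n /cN ->; rewrite v0. Qed.

Lemma expr_lt_pos (d e : R) : 0 <= d < 1 -> 0 < e ->
  exists N, forall n, (N <= n)%N -> d ^+ n < e.
Proof.
move=> /andP[d0 d1] e0.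
have := @cvg_expr R d; rewrite ger0_norm// => /(_ d1)/cvgr0Pnorm_lt/(_ e e0)[N _ NP].
by exists N => n /NP /=; rewrite ger0_norm// exprn_ge0.
Qed.

Lemma vnull_expr y : v y < 1 -> vnull (fun n => y ^+ n).
Proof.
move=> y1; apply/vnullP => e e0.
have [|N NP] := @expr_lt_pos (v y) e _ e0; first by rewrite y1 v_ge0.
by exists N => n /NP; rewrite vX.
Qed.

Definition tsum (c : nat -> K) : K :=
  xget 0 [set l | vcvg v (fun n => \sum_(i < n) c i) l].

Lemma tsum_eq c l : vcvg v (fun n => \sum_(i < n) c i) l -> tsum c = l.
Proof.
move=> cl; rewrite /tsum; apply: xget_unique => // m cm.
exact: vcvg_unique cm cl.
Qed.

Lemma sum_nat_tail c m n : (m <= n)%N ->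
  \sum_(i < n) c i - \sum_(i < m) c i = \sum_(m <= i < n) c i.
Proof.
move=> mn; rewrite -!(big_mkord xpredT c) (big_cat_nat (leq0n m) mn)/=.
by rewrite addrAC subrr add0r.
Qed.

Lemma vnull_terms c l : vcvg v (fun n => \sum_(i < n) c i) l -> vnull c.
Proof.
move=> cl; have := vcvgB (proj2 (@vcvg_shift _ _) cl) cl; rewrite subrr.
by apply: eq_vcvg => n; rewrite big_ord_recr/= addrAC subrr add0r.
Qed.

Section Complete.
Hypothesis complete : forall u, vcauchy v u -> exists l, vcvg v u l.

(** A block of consecutive terms is bounded by its largest term, so the partial sums form a Cauchy
    sequence as soon as the terms tend to 0. *)
Lemma tsumP c : vnull c -> vcvg v (fun n => \sum_(i < n) c i) (tsum c).
Proof.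
move=> c0; have [] := complete (u := fun n => \sum_(i < n) c i).
  move=> e e0; have /vnullP/(_ _ e0)[N NP] := c0; exists N.
  suff H m n : (N <= m)%N -> (m <= n)%N ->
      v (\sum_(i < m) c i - \sum_(i < n) c i) < e.
    move=> m n Nm Nn; case: (leqP m n) => mn; first exact: H.
    by rewrite vBC H// ltnW.
  move=> Nm mn; rewrite vBC sum_nat_tail// big_nat_cond v_sum_lt// => i.
  by rewrite andbT => /andP[mi _]; rewrite NP// (leq_trans Nm).
by move=> l cl; rewrite (tsum_eq cl).
Qed.

Lemma tsum_le c B : vnull c -> (forall i, v (c i) <= B) -> v (tsum c) <= B.
Proof.
move=> c0 cB; apply: (vcvg_le0 (tsumP c0)) => n.
by rewrite v_sum_le// (le_trans (v_ge0 _) (cB 0%N)).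
Qed.

Lemma tsumD c d : vnull c -> vnull d -> tsum (fun i => c i + d i) = tsum c + tsum d.
Proof.
move=> c0 d0; apply: tsum_eq; have := vcvgD (tsumP c0) (tsumP d0).
by apply: eq_vcvg => n; rewrite big_split.
Qed.

Lemma tsumMl x c : vnull c -> tsum (fun i => x * c i) = x * tsum c.
Proof.
move=> c0; apply: tsum_eq; have := vcvgMl x (tsumP c0).
by apply: eq_vcvg => n; rewrite mulr_sumr.
Qed.

Lemma tsumB c d : vnull c -> vnull d -> tsum (fun i => c i - d i) = tsum c - tsum d.
Proof.
move=> c0 d0; apply: tsum_eq; have := vcvgB (tsumP c0) (tsumP d0).
by apply: eq_vcvg => n; rewrite sumrB.
Qed.

Lemma tsum_recl c : vnull c -> tsum c = c 0%N + tsum (fun i => c i.+1).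
Proof.
move=> c0; have c1 : vnull (fun i => c i.+1) by apply/vnull_shift.
apply: tsum_eq; apply/vcvg_shift.
have := vcvgD (vcvg_cst (c 0%N)) (tsumP c1).
by apply: eq_vcvg => n; rewrite big_ord_recl.
Qed.

Lemma tsum_finite c N : (forall n, (N <= n)%N -> c n = 0) ->
  tsum c = \sum_(i < N) c i.
Proof.
move=> cN; apply: tsum_eq; apply/vcvgP => e e0; exists N => n Nn.
rewrite sum_nat_tail// big_nat_cond big1 ?v0// => i.
by rewrite andbT => /andP[/cN].
Qed.

End Complete.
End AbsoluteValueTheory.

(** * Power series on the closed unit disc *)

Section PowerSeries.
Context {R : realType} {K : fieldType} (v : K -> R).
Hypothesis vP : ultrametric_absval v.
Hypothesis vC : forall u, vcauchy v u -> exists l, vcvg v u l.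
Implicit Types (x y z : K) (a b c d u w : nat -> K) (e B : R).

Let v_ge0 := absval_ge0 vP.
Let vM := absvalM vP.

Definition conv a b (n : nat) : K := \sum_(i < n.+1) a i * b (n - i)%N.

Lemma conv_recl a b n : conv a b n.+1 = a 0%N * b n.+1 + conv (fun i => a i.+1) b n.
Proof. by rewrite /conv big_ord_recl subn0. Qed.

Lemma conv_mulr a b y n :
  conv (fun i => a i * y ^+ i) (fun i => b i * y ^+ i) n = conv a b n * y ^+ n.
Proof.
rewrite /conv mulr_suml; apply: eq_bigr => i _.
rewrite mulrACA -exprD subnKC//; exact: (ltn_ord i).
Qed.

Lemma conv_le a b A B n : 0 <= A -> 0 <= B -> (forall i, v (a i) <= A) ->
  (forall i, v (b i) <= B) -> v (conv a b n) <= A * B.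
Proof.
move=> A0 B0 aA bB; rewrite (v_sum_le vP)// ?mulr_ge0// => i _.
by rewrite vM ler_pM.
Qed.

Lemma vnull_conv a b : vnull v a -> vnull v b -> vnull v (conv a b).
Proof.
move=> a0 b0; apply/(vnullP vP) => e e0.
have [A A0 aA] := vnull_bounded vP a0; have [B B0 bB] := vnull_bounded vP b0.
move: a0 b0 => /(vnullP vP)/(_ _ (divr_gt0 e0 B0))[N1 N1P].
move=> /(vnullP vP)/(_ _ (divr_gt0 e0 A0))[N2 N2P].
exists (N1 + N2)%N => n Nn; rewrite (v_sum_lt vP)// => i _; rewrite vM.
case: (leqP N1 i) => Ni.
  have := N1P _ Ni; rewrite ltr_pdivlMr// => h.
  by rewrite (le_lt_trans _ h)// ler_wpM2l.
have /N2P : (N2 <= n - i)%N by lia.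
by rewrite ltr_pdivlMr// mulrC => h; rewrite (le_lt_trans _ h)// ler_wpM2r.
Qed.

(* The defect of multiplicativity is unchanged when the first factor is shifted,
   and it is at most the sup norm of that factor times that of the second one. *)
Lemma tsum_conv a b : vnull v a -> vnull v b ->
  tsum v (conv a b) = tsum v a * tsum v b.
Proof.
move=> a0 b0; apply/subr0_eq/(v_small_eq0 vP) => e e0.
have [B B0 bB] := vnull_bounded vP b0.
have /(vnullP vP)/(_ _ (divr_gt0 e0 B0))[N NP] := a0.
have {}NP n : (N <= n)%N -> v (a n) <= e / B by move/NP/ltW.
(* N bounds the number of leading terms of [a] that may exceed e / B; each shift removes one of
   them. *)
elim: N => [|N IH] in a a0 NP *.
  have eB0 : 0 <= e / B by rewrite divr_ge0// ltW.
  have aeB i : v (a i) <= e / B by rewrite NP.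
  have -> : e = e / B * B by rewrite divfK// gt_eqF.
  rewrite (vB_le vP)//.
    apply: (tsum_le vP vC) => [|n]; first exact: vnull_conv.
    by rewrite conv_le// ltW.
  by rewrite vM ler_pM// (tsum_le vP vC).
have a1 : vnull v (fun i => a i.+1) by apply/(vnull_shift vP).
have b1 : vnull v (fun i => b i.+1) by apply/(vnull_shift vP).
rewrite (tsum_recl vP vC (vnull_conv a0 b0)).
have -> : (fun i => conv a b i.+1) =
    (fun i => a 0%N * b i.+1 + conv (fun i => a i.+1) b i).
  by apply/funext => i; rewrite conv_recl.
rewrite (tsumD vP vC) ?(tsumMl vP vC)//; [|exact: vnullMl|exact: vnull_conv].
rewrite /conv big_ord_recl big_ord0/= addr0 addrA -mulrDr.
rewrite -(tsum_recl vP vC b0) (tsum_recl vP vC a0) mulrDl opprD addrACA subrr add0r.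
by apply: IH => // n Nn; rewrite NP.
Qed.

Definition ev c y : K := tsum v (fun i => c i * y ^+ i).

Lemma ev_cvg c y : vnull v c -> v y <= 1 ->
  vcvg v (fun n => \sum_(i < n) c i * y ^+ i) (ev c y).
Proof. by move=> c0 y1; apply: (tsumP vP vC); apply: vnull_mulr. Qed.

Lemma ev_conv a b y : vnull v a -> vnull v b -> v y <= 1 ->
  ev (conv a b) y = ev a y * ev b y.
Proof.
move=> a0 b0 y1; rewrite -tsum_conv; [|exact: vnull_mulr..].
by congr tsum; apply/funext => n; rewrite conv_mulr.
Qed.

Lemma ev_le c y B : vnull v c -> v y <= 1 -> (forall i, v (c i) <= B) ->
  v (ev c y) <= B.
Proof.
move=> c0 y1 cB; rewrite (tsum_le vP vC)//; first exact: vnull_mulr.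
by move=> i; rewrite (v_mulr_le vP)// (v_expr_le1 vP).
Qed.

Lemma ev_recl c y : vnull v c -> v y <= 1 ->
  ev c y = c 0%N + y * ev (fun i => c i.+1) y.
Proof.
move=> c0 y1; rewrite /ev (tsum_recl vP vC); last exact: vnull_mulr.
rewrite expr0 mulr1 -(tsumMl vP vC); last by apply: vnull_mulr => //; exact/(vnull_shift vP).
by congr (_ + tsum _ _); apply/funext => i; rewrite exprS mulrCA.
Qed.

Lemma ev_at0 c : ev c 0 = c 0%N.
Proof.
rewrite /ev (@tsum_finite _ _ _ vP _ 1); first by rewrite big_ord1 expr0 mulr1.
by move=> [|n]//= _; rewrite exprS mul0r mulr0.
Qed.

Definition sdelta (n : nat) : K := (n == 0%N)%:R.

Lemma ev_sdelta y : ev sdelta y = 1.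
Proof.
rewrite /ev (@tsum_finite _ _ _ vP _ 1); first by rewrite big_ord1 expr0 mulr1.
by move=> [|n]//= _; rewrite /sdelta mul0r.
Qed.

(* The first n coefficients of 1/u, for a series u with u 0 = 1. *)
Fixpoint sinv_seq u (n : nat) : seq K :=
  if n is n'.+1 then
    let s := sinv_seq u n' in
    rcons s ((n' == 0%N)%:R - \sum_(i < n') u i.+1 * s`_(n'.-1 - i))
  else [::].

Definition sinv u n : K := (sinv_seq u n.+1)`_n.

Lemma size_sinv_seq u n : size (sinv_seq u n) = n.
Proof. by elim: n => //= n IH; rewrite size_rcons IH. Qed.

Lemma sinv_seqE u n i : (i < n)%N -> (sinv_seq u n)`_i = sinv u i.
Proof.
elim: n => // n IH; rewrite ltnS leq_eqVlt => /predU1P[->//|lin].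
by rewrite /= nth_rcons size_sinv_seq lin IH.
Qed.

(** The coefficient of index n in u * (1/u) = 1, solved for its last unknown; no division occurs
    because the constant term of u is 1. *)
Lemma sinvE u n :
  sinv u n = (n == 0%N)%:R - \sum_(i < n) u i.+1 * sinv u (n.-1 - i).
Proof.
rewrite {1}/sinv /= nth_rcons size_sinv_seq ltnn eqxx; congr (_ - _).
by apply: eq_bigr => i _; rewrite sinv_seqE//; have := ltn_ord i; lia.
Qed.

Lemma conv_sinv u : u 0%N = 1 -> conv u (sinv u) =1 sdelta.
Proof.
move=> u01 n; rewrite /conv big_ord_recl subn0 u01 mul1r [sinv u n]sinvE.
rewrite -addrA addrC -[RHS]add0r; congr (_ + _); apply/eqP; rewrite addrC subr_eq0; apply/eqP.
by apply: eq_bigr => i _; congr (_ * sinv u _); rewrite /= /bump; have := ltn_ord i; lia.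
Qed.

(** Only finitely many terms exceed 1/2, so the strict bounds become one uniform bound. *)
Lemma vnull_lt1 u : vnull v u -> (forall i, v (u i) < 1) ->
  exists2 d, 0 < d < 1 & forall i, v (u i) <= d.
Proof.
move=> /(vnullP vP)/(_ (2^-1))[|N NP]; first by rewrite invr_gt0.
move=> u1; elim: N NP => [|N IH] NP.
  by exists 2^-1; [lra|move=> i; exact/ltW/NP].
exists (Num.max 2^-1 (\big[Num.max/0]_(i < N.+1) v (u i))).
  rewrite lt_max invr_gt0 ltr0n/= gt_max; apply/andP; split; first lra.
  by elim/big_rec: _ => // i x _ x1; rewrite gt_max u1.
move=> i; rewrite le_max; have [Ni|iN] := leqP N.+1 i.
  by rewrite (ltW (NP i Ni)).
by apply/orP; right; exact: (le_bigmax _ (fun i : 'I_N.+1 => v (u i)) (Ordinal iN)).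
Qed.

(** Equivalently, u - 1 has no constant term and Gauss norm less than 1. Such a u has an inverse
    series that converges on the whole closed disc. *)
Definition unit_series u :=
  [/\ vnull v u, u 0%N = 1 & forall i, v (u i.+1) < 1].

Lemma sinv_le1 u n : unit_series u -> v (sinv u n) <= 1.
Proof.
move=> [u0 u01 u1]; elim/ltn_ind: n => n IH.
rewrite sinvE (vB_le vP)//; first by case: (n == _); rewrite ?(v0 vP) ?(v1 vP).
rewrite (v_sum_le vP)// => i _; rewrite (v_mulr_le vP)//; first exact/ltW/u1.
by apply: IH; have := ltn_ord i; lia.
Qed.

(** By induction on j, the coefficients are eventually at most d^j: in the recursion, either the
    coefficient of u is already small, or the earlier coefficient of the inverse has a large index
    and one more factor d is gained. *)
Lemma vnull_sinv u : unit_series u -> vnull v (sinv u).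
Proof.
move=> uU; have [u0 u01 u1] := uU.
have us : vnull v (fun i => u i.+1) by apply/(vnull_shift vP).
have [d /andP[d0 d1] ud] := vnull_lt1 us u1.
have H j : exists N, forall n, (N <= n)%N -> v (sinv u n) <= d ^+ j.
  elim: j => [|j [N NP]].
    by exists 0%N => n _; rewrite expr0 sinv_le1.
  have /(vnullP vP)/(_ (d ^+ j.+1))[|L LP] := us; first by rewrite exprn_gt0.
  exists (N + L).+1 => n Nn; rewrite sinvE (_ : n == 0%N = false); last by lia.
  rewrite sub0r (vN vP) (v_sum_le vP) ?exprn_ge0 ?(ltW d0)// => i _.
  case: (leqP L i) => iL.
    by rewrite (v_mulr_le vP)// ?sinv_le1//; exact/ltW/LP.
  rewrite vM exprS ler_pM//; apply: NP; lia.
apply/(vnullP vP) => e e0.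
have [|j /(_ _ (leqnn j)) jP] := @expr_lt_pos _ d e _ e0; first by rewrite d1 ltW.
by have [N NP] := H j; exists N => n /NP h; exact: le_lt_trans h jP.
Qed.

Lemma ev_sinv u y : unit_series u -> v y <= 1 -> ev u y * ev (sinv u) y = 1.
Proof.
move=> uU y1; have [u0 u01 u1] := uU.
rewrite -ev_conv//; last exact: vnull_sinv.
by rewrite (funext (conv_sinv u01)) ev_sdelta.
Qed.

Lemma ev_unit_neq0 u y : unit_series u -> v y <= 1 -> ev u y != 0.
Proof.
move=> uU y1; apply/eqP => u0.
by have := ev_sinv uU y1; rewrite u0 mul0r => /esym/eqP; rewrite oner_eq0.
Qed.

(* The coefficients of (c(Y) - c(x)) / (Y - x). *)
Definition sdiv x c (j : nat) : K := ev (fun i => c (j.+1 + i)%N) x.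

Lemma sdiv_rec x c j : vnull v c -> v x <= 1 ->
  sdiv x c j = c j.+1 + x * sdiv x c j.+1.
Proof.
move=> c0 x1; rewrite /sdiv ev_recl//; last exact: (vnull_shiftn vP _ c0).
rewrite addn0; have -> // : (fun i => c (j.+1 + i.+1)%N) = (fun i => c (j.+2 + i)%N).
by apply/funext => i; congr c; lia.
Qed.

Lemma ev_sdiv0 x c : vnull v c -> v x <= 1 -> ev c x = c 0%N + x * sdiv x c 0.
Proof. by move=> c0 x1; rewrite ev_recl. Qed.

Lemma sdiv_le x c B j : vnull v c -> v x <= 1 ->
  (forall i, (j < i)%N -> v (c i) <= B) -> v (sdiv x c j) <= B.
Proof.
move=> c0 x1 cB; rewrite ev_le//; first exact: (vnull_shiftn vP _ c0).
by move=> i; rewrite cB//; lia.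
Qed.

Lemma vnull_sdiv x c : vnull v c -> v x <= 1 -> vnull v (sdiv x c).
Proof.
move=> c0 x1; apply/(vnullP vP) => e e0.
have /(vnullP vP)/(_ (e / 2))[|N NP] := c0; first by rewrite divr_gt0.
exists N => n Nn; apply: (@le_lt_trans _ _ (e / 2)); last lra.
by rewrite sdiv_le// => i ni; rewrite ltW// NP//; lia.
Qed.

(** The recursion of [sdiv] telescopes: partial sums of both sides differ only by the boundary term
    [sdiv x c n * y ^+ n.+1], which tends to 0. *)
Lemma ev_sdiv x y c : vnull v c -> v x <= 1 -> v y <= 1 ->
  ev c y = ev c x + (y - x) * ev (sdiv x c) y.
Proof.
move=> c0 x1 y1; have d0 := vnull_sdiv c0 x1.
apply: (vcvg_unique vP (ev_cvg c0 y1)); apply/(vcvg_shift vP).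
have dy : vnull v (fun n => sdiv x c n * y ^+ n.+1).
  apply: (@vnull_le _ _ _ vP (sdiv x c) _ 1) => // n.
  by rewrite mul1r (v_mulr_le vP)// (v_expr_le1 vP).
have := vcvgB vP (vcvgD vP (vcvg_cst vP (ev c x))
  (vcvgMl vP (y - x) (proj2 (vcvg_shift vP _ _) (ev_cvg d0 y1)))) dy.
rewrite subr0; apply: eq_vcvg => n; rewrite ev_sdiv0//.
elim: n => [|n IH].
  by rewrite !big_ord_recl !big_ord0/= (sdiv_rec 0)// expr0 expr1; ring.
rewrite big_ord_recr/= [RHS]big_ord_recr/= -IH (sdiv_rec n)// (sdiv_rec n.+1)// !exprS.
ring.
Qed.

(** Iterated divided differences at x yield the Taylor coefficients without division by factorials,
    which would spoil the uniform bound of [iter_sdiv]. *)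
Lemma ev_taylor x y c J : vnull v c -> v x <= 1 -> v y <= 1 ->
  ev c y = \sum_(j < J) ev (iter j (sdiv x) c) x * (y - x) ^+ j
           + (y - x) ^+ J * ev (iter J (sdiv x) c) y.
Proof.
move=> c0 x1 y1; elim: J => [|J IH]; first by rewrite big_ord0 add0r expr0 mul1r.
have cJ0 : vnull v (iter J (sdiv x) c) by elim: J {IH} => //= J ?; exact: vnull_sdiv.
by rewrite IH big_ord_recr/= (@ev_sdiv x y (iter J (sdiv x) c))// exprSr; ring.
Qed.

Lemma iter_sdiv x c B J : vnull v c -> v x <= 1 -> (forall i, v (c i) <= B) ->
  vnull v (iter J (sdiv x) c) /\ forall i, v (iter J (sdiv x) c i) <= B.
Proof.
move=> c0 x1 cB; elim: J => //= J [IH1 IH2]; split; first exact: vnull_sdiv.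
by move=> i; rewrite sdiv_le.
Qed.

Definition sderiv c (n : nat) : K := n.+1%:R * c n.+1.

Lemma vnull_sderiv c : vnull v c -> vnull v (sderiv c).
Proof.
move=> c0; have : vnull v (fun i => c i.+1) by apply/(vnull_shift vP).
apply: (@vnull_le _ _ _ vP _ _ 1) => n.
by rewrite mul1r /sderiv mulrC (v_mulr_le vP)// (v_nat_le1 vP).
Qed.

(** Telescoping again; the boundary term [n.+1%:R * (sdiv x c n * x ^+ n)] tends to 0 because
    integers have absolute value at most 1. *)
Lemma ev_sderiv x c : vnull v c -> v x <= 1 -> ev (sdiv x c) x = ev (sderiv c) x.
Proof.
move=> c0 x1; have d0 := vnull_sdiv c0 x1; have c'0 := vnull_sderiv c0.
have e0 : vnull v (fun n => sdiv x c n * x ^+ n) by apply: vnull_mulr.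
have ne0 : vnull v (fun n => n.+1%:R * (sdiv x c n * x ^+ n)).
  apply: (@vnull_le _ _ _ vP _ _ 1) e0 => n.
  by rewrite mul1r mulrC (v_mulr_le vP)// (v_nat_le1 vP).
apply: (vcvg_unique vP _ (ev_cvg c'0 x1)).
have := vcvgB vP (proj2 (vcvg_shift vP _ _) (ev_cvg d0 x1)) ne0.
rewrite subr0; apply: eq_vcvg => n; elim: n => [|n IH].
  by rewrite !big_ord_recl !big_ord0; ring.
rewrite big_ord_recr/= [RHS]big_ord_recr/= -IH /sderiv (sdiv_rec n)// !exprS -!natr1.
ring.
Qed.

End PowerSeries.

(** * The ring of algebraic elements over Q_p *)

Section PadicNumbers.
Context {R : realType} {K : fieldType} (v : K -> R) (p : nat).
Hypothesis p_prime : prime p.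
Hypothesis KCp : is_Cp p v.
Implicit Types (x y z : K) (q : rat).

Let vP := Cp_absval KCp.
Let v_ge0 := absval_ge0 vP.
Let vM := absvalM vP.

Lemma v_p_lt1 : v p%:R < 1.
Proof. by rewrite (Cp_p KCp) invf_lt1 ?ltr0n ?ltr1n ?prime_gt0 ?prime_gt1. Qed.

Lemma p_neq0 : p%:R != 0 :> K.
Proof. by rewrite -(v_gt0 vP) (Cp_p KCp) invr_gt0 ltr0n prime_gt0. Qed.

(** By Bezout some multiple of n is 1 plus a multiple of p, hence of absolute value 1; both of its
    factors have absolute value at most 1. *)
Lemma v_nat_coprime n : coprime n p -> v n%:R = 1.
Proof.
case: n => [|n]; first by rewrite /coprime gcd0n => /eqP p1; move: p_prime; rewrite p1.
move=> /(coprimeP p (ltn0Sn n))[[a b] /= ab].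
have {}ab : (a * n.+1 = 1 + b * p)%N by lia.
have va : v (a * n.+1)%:R = 1.
  rewrite -[RHS](v1 vP); apply: (v_dom vP); rewrite ab natrD addrAC subrr add0r (v1 vP).
  by rewrite natrM mulrC (v_mulr_lt vP)// ?v_p_lt1// (v_nat_le1 vP).
apply/eqP; rewrite eq_le (v_nat_le1 vP)/= -va natrM mulrC (v_mulr_le vP)//.
exact: (v_nat_le1 vP).
Qed.

Lemma natK_neq0 n : (0 < n)%N -> n%:R != 0 :> K.
Proof.
move=> n0; have [m pm ->] := pfactor_coprime p_prime n0.
rewrite natrM natrX mulf_neq0 ?expf_neq0 ?p_neq0//.
by rewrite -(v_gt0 vP) v_nat_coprime ?ltr01// coprime_sym.
Qed.

Lemma intK_eq0 (m : int) : (m%:~R == 0 :> K) = (m == 0).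
Proof.
apply/idP/eqP => [|->]; last by rewrite eqxx.
case: m => [[|n]|n]//; rewrite ?NegzE ?mulrNz ?oppr_eq0 => /eqP h.
  by have := natK_neq0 (ltn0Sn n); rewrite -pmulrn in h; rewrite h eqxx.
by have := natK_neq0 (ltn0Sn n); rewrite -pmulrn in h; rewrite h eqxx.
Qed.

(** [ratr] is computed from the reduced fraction; its compatibility with sums and products rests on
    independence of the representing fraction, that is, on characteristic 0. *)
Lemma ratr_frac q (n d : int) : d != 0 -> q * d%:~R = n%:~R ->
  ratr q = n%:~R / d%:~R :> K.
Proof.
move=> d0 qdn; rewrite /ratr.
have e : (numq q * d = n * denq q)%R.
  apply: (@intr_inj rat); rewrite !intrM -qdn -{2}(divq_num_den q).
  by rewrite mulrAC divfK// intr_eq0 denq_neq0.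
apply/eqP; rewrite eqr_div ?intK_eq0 ?denq_neq0//.
by rewrite -!intrM e.
Qed.

Lemma ratr_add q1 q2 : ratr (q1 + q2) = ratr q1 + ratr q2 :> K.
Proof.
rewrite (@ratr_frac _ (numq q1 * denq q2 + numq q2 * denq q1) (denq q1 * denq q2)).
- rewrite /ratr addf_div ?intK_eq0 ?denq_neq0//.
  by rewrite !intrM intrD !intrM.
- by rewrite mulf_neq0 ?denq_neq0.
- rewrite intrD !intrM -{1}(divq_num_den q1) -{1}(divq_num_den q2).
  by field; rewrite !intr_eq0 !denq_neq0.
Qed.

Lemma ratr_mul q1 q2 : ratr (q1 * q2) = ratr q1 * ratr q2 :> K.
Proof.
rewrite (@ratr_frac _ (numq q1 * numq q2) (denq q1 * denq q2)).
- by rewrite /ratr !intrM mulf_div.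
- by rewrite mulf_neq0 ?denq_neq0.
- rewrite !intrM -{1}(divq_num_den q1) -{1}(divq_num_den q2).
  by field; rewrite !intr_eq0 !denq_neq0.
Qed.

Lemma ratr_one : ratr 1 = 1 :> K.
Proof. exact: (ratr_int K 1). Qed.

Lemma ratr_zero : ratr 0 = 0 :> K.
Proof. exact: (ratr_int K 0). Qed.

Lemma ratr_opp q : ratr (- q) = - ratr q :> K.
Proof.
apply/eqP; rewrite -subr_eq0 opprK -ratr_add addNr.
by rewrite ratr_zero.
Qed.

Lemma Qp_rat q : Qp v (ratr q).
Proof. by exists (fun=> q); exact: vcvg_cst. Qed.

Lemma Qp_int (m : int) : Qp v m%:~R.
Proof. by rewrite -[m%:~R]ratr_int; exact: Qp_rat. Qed.

Lemma vcvg_mul (u w : nat -> K) l m : vcvg v u l -> vcvg v w m ->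
  vcvg v (fun n => u n * w n) (l * m).
Proof.
move=> ul wm.
have a0 : vnull v (fun n => u n - l).
  by have := vcvgB vP ul (vcvg_cst vP l); rewrite subrr.
have b0 : vnull v (fun n => w n - m).
  by have := vcvgB vP wm (vcvg_cst vP m); rewrite subrr.
have [B B0 aB] := vnull_bounded vP a0.
have ab0 : vnull v (fun n => (u n - l) * (w n - m)).
  apply: (@vnull_le _ _ _ vP _ _ B) b0 => n.
  by rewrite vM ler_wpM2r.
have := vcvgD vP (vcvgD vP (vcvgD vP ab0 (vnullMl vP l b0)) (vnullMl vP m a0))
  (vcvg_cst vP (l * m)).
by rewrite !add0r; apply: eq_vcvg => n; ring.
Qed.

Lemma Qp_subring : subring_closed (fun x => `[< Qp v x >]).
Proof.
split; first by apply/asboolP; exact: (Qp_int 1).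
  move=> x y /asboolP[u ux] /asboolP[w wy]; apply/asboolP.
  exists (fun n => u n - w n); have := vcvgB vP ux wy.
  by apply: eq_vcvg => n; rewrite ratr_add ratr_opp.
move=> x y /asboolP[u ux] /asboolP[w wy]; apply/asboolP.
exists (fun n => u n * w n); have := vcvg_mul ux wy.
by apply: eq_vcvg => n; rewrite ratr_mul.
Qed.

End PadicNumbers.

(* The proofs are parameters so that the ring structure can be inferred. *)
Definition in_Qp (R : realType) (K : fieldType) (v : K -> R) (p : nat)
  (p_prime : prime p) (KCp : is_Cp p v) : pred K := fun x => `[< Qp v x >].

Section QpRing.
Context {R : realType} {K : fieldType} (v : K -> R) (p : nat).
Context (p_prime : prime p) (KCp : is_Cp p v).

HB.instance Definition _ :=
  GRing.isSubringClosed.Build K (in_Qp p_prime KCp) (Qp_subring p_prime KCp).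

Record QpRing := QpElt { Qp_val :> K; _ : Qp_val \in in_Qp p_prime KCp }.

HB.instance Definition _ := [isSub for Qp_val].
HB.instance Definition _ := [Choice of QpRing by <:].
HB.instance Definition _ := [SubChoice_isSubComNzRing of QpRing by <:].

Let toK : {rmorphism QpRing -> K} := val.

(** [Qpbar] is defined by monic relations, so its stability under sums and products is that of
    integral elements over the ring [QpRing]. *)
Lemma Qpbar_integral x : Qpbar v x <-> integralOver toK x.
Proof.
split=> [[P [Pm PQ Px]]|[P Pm Px]]; last first.
  exists (map_poly toK P); split => //; first by rewrite monic_map.
  by move=> i; rewrite coef_map/=; apply/asboolP; case: (P`_i).
have PQ' i : P`_i \in in_Qp p_prime KCp by apply/asboolP.
pose P' : {poly QpRing} := \poly_(i < size P) QpElt (PQ' i).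
have PP' : map_poly toK P' = P.
  apply/polyP => i; rewrite coef_map coef_poly; case: ltnP => //= iP.
  by rewrite nth_default.
have sPP' : size P = size P'.
  by rewrite -PP' size_map_inj_poly ?rmorph0//; exact: val_inj.
exists P'; last by rewrite PP'.
apply/monicP/val_inj; rewrite lead_coefE -sPP' -[LHS]/(toK _) -coef_map PP'.
by rewrite -lead_coefE (monicP Pm).
Qed.

Lemma Qpbar_add x y : Qpbar v x -> Qpbar v y -> Qpbar v (x + y).
Proof. by rewrite !Qpbar_integral; exact: integral_add. Qed.

Lemma Qpbar_mul x y : Qpbar v x -> Qpbar v y -> Qpbar v (x * y).
Proof. by rewrite !Qpbar_integral; exact: integral_mul. Qed.

Lemma Qpbar_int (m : int) : Qpbar v m%:~R.
Proof. by rewrite Qpbar_integral -(rmorph_int toK); exact: integral_id. Qed.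

End QpRing.

(** * Zeros of power series *)

Section Zeros.
Context {R : realType} {K : fieldType} (v : K -> R) (p : nat).
Hypothesis p_prime : prime p.
Hypothesis KCp : is_Cp p v.
Implicit Types (x y z : K) (a b c d u w : nat -> K) (P Q : {poly K}).

Let vP := Cp_absval KCp.
Let vC := Cp_complete KCp.
Let v_ge0 := absval_ge0 vP.
Let vM := absvalM vP.

(* The Gauss norm of c is 1 and is attained for the last time at N. *)
Definition Wdeg c N :=
  [/\ forall i, v (c i) <= 1, v (c N) = 1 & forall i, (N < i)%N -> v (c i) < 1].

Lemma vnull_poly P : vnull v (fun i => P`_i).
Proof. by apply: (vnull_finite vP (N := size P)) => n; exact: nth_default. Qed.

Lemma ev_poly P x : ev v (fun i => P`_i) x = P.[x].
Proof.
rewrite /ev (@tsum_finite _ _ _ vP _ (size P)) ?horner_coef//.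
by move=> n /(nth_default 0) ->; rewrite mul0r.
Qed.

Lemma ev_congr c d x B : vnull v c -> vnull v d -> v x <= 1 ->
  (forall i, v (c i - d i) <= B) -> v (ev v c x - ev v d x) <= B.
Proof.
move=> c0 d0 x1 cd; rewrite /ev -(tsumB vP vC); [|exact: vnull_mulr..].
have -> : (fun i => c i * x ^+ i - d i * x ^+ i) = (fun i => (c i - d i) * x ^+ i).
  by apply/funext => i; rewrite mulrBl.
apply: (@ev_le _ _ _ vP vC (fun i => c i - d i)) => //.
by have := vnullD vP c0 (vnullMl vP (-1) d0); apply: eq_vnull => i; rewrite mulN1r.
Qed.

Lemma ev_lipschitz c x y : vnull v c -> v x <= 1 -> v y <= 1 ->
  (forall i, v (c i) <= 1) -> v (ev v c y - ev v c x) <= v (y - x).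
Proof.
move=> c0 x1 y1 cB; rewrite (ev_sdiv vP vC c0 x1 y1) addrAC subrr add0r.
rewrite (v_mulr_le vP)// (ev_le vP vC)//; first exact: vnull_sdiv.
by move=> i; apply: (sdiv_le vP vC).
Qed.

(* The hypotheses on c and d say that c = (Y - y) d. *)
Lemma Wdeg_quotient y c d N : v y <= 1 -> vnull v d ->
  (forall j, c j.+1 = d j - y * d j.+1) -> Wdeg c N.+1 -> Wdeg d N.
Proof.
move=> y1 d0 cd [c1 cN cgt].
(* Far out, d is below e because it is a null sequence; the relation d j = c j.+1 + y * d j.+1
   carries the bound back down to j. *)
have H (e : R) j : 0 < e -> (forall i, (j < i)%N -> v (c i) < e) -> v (d j) < e.
  move=> e0 ce; have /(vnullP vP)/(_ e e0)[n nP] := d0.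
  have := nP (j + n)%N (leq_addl _ _).
  elim: n j {nP} ce => [|n IH] j ce; first by rewrite addn0.
  move=> djn; have -> : d j = c j.+1 + d j.+1 * y by rewrite cd; ring.
  rewrite (vD_lt vP) ?ce// (v_mulr_lt vP)// IH//; last by rewrite addSnnS.
  by move=> i ji; rewrite ce// ltnW.
have dlt j : (N < j)%N -> v (d j) < 1.
  by move=> Nj; apply: H => // i ji; rewrite cgt//; lia.
split=> //.
- move=> i; apply/ler_addgt0Pr => e e0; rewrite ltW// H ?addr_gt0// => j _.
  by rewrite (le_lt_trans (c1 j))// ltrDl.
- rewrite -cN cd; symmetry; apply: (v_dom vP); rewrite addrAC subrr add0r (vN vP).
  have h : v (y * d N.+1) < 1 by rewrite mulrC (v_mulr_lt vP)// dlt.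
  suff -> : v (d N) = 1 by [].
  rewrite -cN cd; apply: (v_dom vP).
  by rewrite opprB addrCA subrr addr0 -cd cN.
Qed.

Definition over_Qpbar P := forall i, Qpbar v P`_i.

Lemma coef_mul_XsubC Q y i :
  (Q * ('X - y%:P))`_i.+1 = Q`_i - y * Q`_i.+1.
Proof. by rewrite mulrBr coefB coefMX coefMC mulrC. Qed.

(** The coefficients of the quotient are recovered from the top downwards by Horner's rule, using
    only sums and products in [Qpbar]. *)
Lemma over_Qpbar_factor P y : over_Qpbar P -> Qpbar v y -> root P y ->
  exists2 Q, P = Q * ('X - y%:P) & over_Qpbar Q.
Proof.
move=> PQ yQ /factor_theorem[Q PE]; exists Q => // i.
have [k] := ubnP (size Q - i); elim: k i => // k IH i; rewrite ltnS => ik.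
have [sQi|iQ] := leqP (size Q) i; first by rewrite nth_default//; exact: (Qpbar_int p_prime KCp 0).
have -> : Q`_i = P`_i.+1 + y * Q`_i.+1 by rewrite PE coef_mul_XsubC subrK.
by apply: (Qpbar_add p_prime KCp) => //; apply: (Qpbar_mul p_prime KCp) => //; apply: IH; lia.
Qed.

(* A root y outside the unit disc is divided out: up to the factor -y the
   quotient has the same reduction. *)
Lemma Qpbar_disc_root P N : over_Qpbar P -> Wdeg (fun i => P`_i) N.+1 ->
  exists y, [/\ Qpbar v y, v y <= 1 & root P y].
Proof.
have [D] := ubnP (size P); elim: D P => // D IH P; rewrite ltnS => sP PQ PW.
have [c1 cN cgt] := PW.
have PN0 : P`_N.+1 != 0 by rewrite -(v_gt0 vP) cN.
have sNP : (N.+1 < size P)%N.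
  by rewrite ltnNge; apply: contra PN0 => /(nth_default 0) ->.
have [y [yQ yP]] := Cp_Qpbar_closed KCp PQ (leq_ltn_trans (ltn0Sn N) sNP).
have [y1|y1] := leP (v y) 1; first by exists y.
have [Q PE QQ] := over_Qpbar_factor PQ yQ yP.
have y0 : y != 0 by rewrite -(v_gt0 vP) (lt_trans _ y1).
have Q0 : Q != 0 by apply: contraNneq PN0 => Q0; rewrite PE Q0 mul0r coef0.
(* With this scaling P = (1 - X / y) Q', and |1 / y| < 1, so P and Q' agree up to coefficients of
   absolute value less than 1. *)
pose Q' := (- y) *: Q.
have Q'Q : over_Qpbar Q'.
  move=> i; rewrite coefZ; apply: (Qpbar_mul p_prime KCp) => //.
  by rewrite -mulN1r; apply: (Qpbar_mul p_prime KCp) => //; exact: (Qpbar_int p_prime KCp (-1)).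
have sQ' : (size Q' < D)%N.
  rewrite size_scale ?oppr_eq0//; move: sP.
  by rewrite PE size_Mmonic ?monicXsubC// size_XsubC addn2 /=.
have P0 : P`_0 = Q'`_0 by rewrite PE coefZ mulrBr coefB coefMX coefMC/=; ring.
have PS i : P`_i.+1 = Q'`_i.+1 - y^-1 * Q'`_i.
  by rewrite PE coef_mul_XsubC !coefZ !mulNr mulrN opprK mulKf// addrC.
have yV : v y^-1 < 1 by rewrite (vV vP) invf_lt1// (lt_trans _ y1).
have QS i : Q'`_i.+1 = P`_i.+1 + y^-1 * Q'`_i by rewrite PS subrK.
have Q'1 i : v Q'`_i <= 1.
  elim: i => [|i IHi]; first by rewrite -P0.
  by rewrite QS (vD_le vP)// (v_mulr_le vP)//; exact: ltW.
have yQ1 i : v (y^-1 * Q'`_i) < 1 by rewrite (v_mulr_lt vP).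
have [|z [zQ z1 zQ']] := IH Q' sQ' Q'Q.
  split=> //.
    by rewrite -cN; apply: (v_dom vP); rewrite QS addrAC subrr add0r cN.
  by case=> // i Ni; rewrite QS (vD_lt vP)// cgt.
exists z; split=> //; rewrite PE rootM; move: zQ'.
by rewrite rootZ ?oppr_eq0// => ->.
Qed.

Lemma Wdeg0_ev c x : vnull v c -> v x <= 1 -> Wdeg c 0 -> v (ev v c x) = 1.
Proof.
move=> c0 x1 [c1 cN cgt]; rewrite -cN; apply: (v_dom vP).
rewrite (ev_recl vP vC)// addrAC subrr add0r cN mulrC (v_mulr_lt vP)//.
have cs : vnull v (fun i => c i.+1) by apply/(vnull_shift vP).
have [|d /andP[d0 d1] cd] := vnull_lt1 vP cs; first by move=> i; exact: cgt.
by rewrite (le_lt_trans _ d1)// (ev_le vP vC).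
Qed.

(** Once the N.+1 roots in the disc are split off, the remaining factor has absolute value 1 on the
    disc. So |P(x)| is the product of the distances from x to these roots, and the nearest root
    satisfies the bound. *)
Lemma near_root P N x : over_Qpbar P -> Wdeg (fun i => P`_i) N.+1 -> v x <= 1 ->
  exists y, [/\ v y <= 1, root P y & v (x - y) ^+ N.+1 <= v P.[x]].
Proof.
move=> PQ PW x1; elim: N P PQ PW => [|N IH] P PQ PW.
  have [y [yQ y1 yP]] := Qpbar_disc_root PQ PW.
  have [Q PE QQ] := over_Qpbar_factor PQ yQ yP.
  exists y; split=> //; rewrite expr1 PE hornerM vM !hornerE.
  rewrite -ev_poly Wdeg0_ev ?mul1r//; first exact: vnull_poly.
  apply: (Wdeg_quotient y1 (vnull_poly Q) _ PW) => j.
  by rewrite PE coef_mul_XsubC.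
have [y [yQ y1 yP]] := Qpbar_disc_root PQ PW.
have [Q PE QQ] := over_Qpbar_factor PQ yQ yP.
have [|z [z1 zQ zx]] := IH Q QQ.
  apply: (Wdeg_quotient y1 (vnull_poly Q) _ PW) => j.
  by rewrite PE coef_mul_XsubC.
have Px : v P.[x] = v (x - y) * v Q.[x] by rewrite PE hornerM vM !hornerE mulrC.
have [xyz|xyz] := leP (v (x - y)) (v (x - z)).
  exists y; split=> //; rewrite Px exprS ler_wpM2l// (le_trans _ zx)//.
  by rewrite lerXn2r ?nnegrE.
exists z; split=> //; first by rewrite PE rootM zQ.
by rewrite Px exprS ler_pM ?exprn_ge0// ltW.
Qed.

Lemma Qpbar_approx c (e : R) : vnull v c -> 0 < e ->
  exists2 P, over_Qpbar P & forall i, v (P`_i - c i) < e.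
Proof.
move=> c0 e0; have /(vnullP vP)/(_ e e0)[M MP] := c0.
have /choice[g gP] : forall i, exists y, Qpbar v y /\ v (c i - y) < e.
  by move=> i; exact: (Cp_Qpbar_dense KCp).
exists (\poly_(i < M) g i) => i; rewrite coef_poly; case: ltnP => iM.
- by have [] := gP i.
- exact: (Qpbar_int p_prime KCp 0).
- by rewrite (vBC vP); have [] := gP i.
- by rewrite sub0r (vN vP) MP.
Qed.

Lemma Wdeg_congr c d N : (forall i, v (d i - c i) < 1) -> Wdeg c N -> Wdeg d N.
Proof.
move=> dc [c1 cN cgt].
have dE i : d i = (d i - c i) + c i by rewrite subrK.
split=> [i||i Ni]; first by rewrite dE (vD_le vP)// ltW.
  by rewrite -cN; apply: (v_dom vP); rewrite cN.
by rewrite dE (vD_lt vP)// cgt.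
Qed.

(* The zero is the limit of a sequence of roots of approximating polynomials
   over Qpbar, each one the root nearest to the preceding one. *)
Lemma disc_zero c N : vnull v c -> Wdeg c N.+1 -> exists2 y, v y <= 1 & ev v c y = 0.
Proof.
(* The precisions tend to 0 and stay below 1, so every approximating polynomial keeps the
   Weierstrass degree of c. *)
move=> c0 cW; pose eps (m : nat) : R := 2^-1 ^+ m.+1.
have eps0 m : 0 < eps m by rewrite exprn_gt0.
have eps1 m : eps m < 1 by rewrite exprn_ilt1//; lra.
have epsS m : eps m.+1 <= eps m.
  by rewrite /eps [leLHS]exprS ler_piMl ?exprn_ge0//; lra.
have epsN e : 0 < e -> exists M, forall n, (M <= n)%N -> eps n < e.
  move=> e0; have [|M MP] := @expr_lt_pos _ (2^-1) e _ e0; first by lra.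
  by exists M => n Mn; apply: MP; rewrite leqW.
have /choice[P PP] : forall m, exists P, over_Qpbar P /\ forall i, v (P`_i - c i) < eps m.
  by move=> m; have [P] := Qpbar_approx c0 (eps0 m); exists P.
have PW m : Wdeg (fun i => (P m)`_i) N.+1.
  by apply: Wdeg_congr cW => i; rewrite (lt_trans _ (eps1 m))//; have [] := PP m.
have P1 m i : v (P m)`_i <= 1 by have [] := PW m.
have /choice[g gP] : forall mx : nat * K, exists y, v mx.2 <= 1 ->
    [/\ v y <= 1, root (P mx.1) y & v (mx.2 - y) ^+ N.+1 <= v (P mx.1).[mx.2]].
  move=> [m x]/=; have [x1|x1] := boolP (v x <= 1); last by exists 0.
  by have [y yP] := near_root (proj1 (PP m)) (PW m) x1; exists y.
pose s := fix s m := if m is m'.+1 then g (m, s m') else g (0%N, 0).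
have sP m : v (s m) <= 1 /\ root (P m) (s m).
  elim: m => [|m [IH _]] /=.
    by have [] := gP (0%N, 0); rewrite /= ?(v0 vP).
  by have [] := gP (m.+1, s m).
have evP m x : (P m).[x] = ev v (fun i => (P m)`_i) x by rewrite ev_poly.
(* As [s m] is a root of [P m], the value of [P m.+1] there is that of the difference of the two
   polynomials, which has small coefficients. *)
have step m : v (s m.+1 - s m) ^+ N.+1 <= eps m.
  have [sm1 smr] := sP m; have [_ _ h] := gP (m.+1, s m) sm1.
  rewrite (vBC vP) (le_trans h)//= -[X in v X]subr0 -(rootP smr) !evP.
  apply: ev_congr => //; try exact: vnull_poly.
  move=> i; apply: (v_trans_le vP (y := c i)).
    by rewrite ltW// (lt_le_trans _ (epsS m))//; have [] := PP m.+1.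
  by rewrite (vBC vP) ltW//; have [] := PP m.
have ds0 : vnull v (fun m => s m.+1 - s m).
  apply/(vnullP vP) => e e0; have [M MP] := epsN _ (exprn_gt0 N.+1 e0).
  exists M => n Mn; rewrite -(@ltr_pXn2r _ N.+1) ?nnegrE ?(ltW e0)//.
  exact: le_lt_trans (step n) (MP n Mn).
pose l := s 0%N + tsum v (fun m => s m.+1 - s m).
have sl : vcvg v s l.
  have := vcvgD vP (vcvg_cst vP (s 0%N)) (tsumP vP vC ds0).
  apply: eq_vcvg => n; elim: n => [|n IH]; first by rewrite big_ord0 addr0.
  by rewrite big_ord_recr/= addrA IH addrC subrK.
have l1 : v l <= 1 by apply: (vcvg_le0 vP sl) => m; have [] := sP m.
exists l => //; apply: (v_small_eq0 vP) => e e0.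
have [M1 M1P] := epsN _ e0; have /(vcvgP vP)/(_ e e0)[M2 M2P] := sl.
pose m := maxn M1 M2; have [sm1 smr] := sP m.
rewrite -[ev _ _ _]subr0 -(rootP smr) evP.
apply: (v_trans_le vP (y := ev v (fun i => (P m)`_i) l)).
  apply: (ev_congr c0 (@vnull_poly _)) => // i; rewrite (vBC vP) ltW//.
  by apply: (lt_trans (proj2 (PP m) i)); rewrite M1P// leq_maxl.
apply: (le_trans (ev_lipschitz (@vnull_poly _) sm1 l1 (P1 m))).
by rewrite (vBC vP) ltW// M2P// leq_maxr.
Qed.

(** Each zero found by [disc_zero] is divided out with [sdiv], which lowers the degree by one. In
    degree 0 the constant term dominates, and dividing by it leaves a unit series. *)
Lemma weierstrass c N : vnull v c -> Wdeg c N ->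
  exists (k : K) (s : seq K) (u : nat -> K),
    [/\ k != 0, unit_series v u, (forall x, x \in s -> v x <= 1)
      & forall y, v y <= 1 -> ev v c y = k * \prod_(x <- s) (y - x) * ev v u y].
Proof.
elim: N c => [|N IH] c c0 cW.
  have [c1 cN cgt] := cW; have cz : c 0%N != 0 by rewrite -(v_gt0 vP) cN.
  exists (c 0%N), [::], (fun i => (c 0%N)^-1 * c i); split=> //.
    split; [exact: (vnullMl vP)|exact: mulVf|move=> i].
    by rewrite vM (vV vP) cN invr1 mul1r cgt.
  move=> y y1; rewrite big_nil mulr1 /ev -(tsumMl vP vC); last first.
    by apply: vnull_mulr => //; exact: vnullMl.
  by congr tsum; apply/funext => i; rewrite !mulrA mulfV// mul1r.
have [z z1 cz] := disc_zero c0 cW; have d0 := vnull_sdiv vP vC c0 z1.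
have [|k [s [u [k0 uU s1 dE]]]] := IH _ d0.
  by apply: (Wdeg_quotient z1 d0 _ cW) => j; rewrite (sdiv_rec vP vC j c0)// addrK.
exists k, (z :: s), u; split=> //.
  by move=> x; rewrite inE => /predU1P[->//|/s1].
move=> y y1; rewrite (ev_sdiv vP vC c0 z1 y1) cz add0r dE// big_cons; ring.
Qed.

(** A nonzero null sequence attains its maximal absolute value, and does so only finitely often; N
    is the last such index. *)
Lemma exists_Wdeg c i0 : vnull v c -> c i0 != 0 ->
  exists2 N, c N != 0 & Wdeg (fun i => (c N)^-1 * c i) N.
Proof.
move=> c0 ci0; have vci0 : 0 < v (c i0) by rewrite (v_gt0 vP).
have /(vnullP vP)/(_ _ vci0)[M MP] := c0.
have i0M : (i0 < M)%N by rewrite ltnNge; apply/negP => /MP; rewrite ltxx.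
pose top n := `[< forall i, v (c i) <= v (c n) >].
have topE : exists n, top n.
  pose F (i : 'I_M) := v (c i).
  have [n _ nP] := @arg_maxP _ _ _ (Ordinal i0M) xpredT F isT.
  exists n; apply/asboolP => i; have [Mi|iM] := leqP M i.
    exact: (le_trans (ltW (MP i Mi)) (nP (Ordinal i0M) isT)).
  exact: (nP (Ordinal iM) isT).
have topM n : top n -> (n <= M)%N.
  move=> /asboolP/(_ i0) h; rewrite leqNgt; apply/negP => /ltnW/MP.
  by rewrite ltNge h.
have [N /asboolP Ntop Nmax] := ex_maxnP topE topM.
have vcN : 0 < v (c N) := lt_le_trans vci0 (Ntop i0).
exists N; first by rewrite -(v_gt0 vP).
split=> [i||i Ni]; rewrite vM (vV vP) mulrC.
- by rewrite ler_pdivrMr ?mul1r.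
- by rewrite divff ?gt_eqF.
- rewrite ltr_pdivrMr ?mul1r// ltNge; apply/negP => h.
  have : top i by apply/asboolP => j; exact: le_trans (Ntop j) h.
  by move/Nmax; rewrite leqNgt Ni.
Qed.

Lemma weierstrass_nonzero c : vnull v c -> (exists i, c i <> 0) ->
  exists (k : K) (s : seq K) (u : nat -> K),
    [/\ k != 0, unit_series v u, (forall x, x \in s -> v x <= 1)
      & forall y, v y <= 1 -> ev v c y = k * \prod_(x <- s) (y - x) * ev v u y].
Proof.
move=> c0 [i0 /eqP ci0]; have [N cN cW] := exists_Wdeg c0 ci0.
have [k [s [u [k0 uU s1 E]]]] := weierstrass (vnullMl vP _ c0) cW.
exists (c N * k), s, u; split=> //; first exact: mulf_neq0.
move=> y y1; rewrite -!mulrA [k * _]mulrA -E// /ev -(tsumMl vP vC); last first.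
  by apply: vnull_mulr => //; exact: vnullMl.
by congr tsum; apply/funext => i; rewrite !mulrA mulfV// mul1r.
Qed.

End Zeros.

(** * Roots of unity and the Teichmuller character *)

Section RootsOfUnity.
Context {R : realType} {K : fieldType} (v : K -> R) (p : nat).
Hypothesis p_prime : prime p.
Hypothesis KCp : is_Cp p v.
Implicit Types (x y z t w : K).

Let vP := Cp_absval KCp.
Let v_ge0 := absval_ge0 vP.
Let vM := absvalM vP.

(** * Algebraic elements modulo elements of absolute value less than 1 *)

Lemma v_int_ndvd (m : int) : ~~ (p %| m)%Z -> v m%:~R = 1.
Proof.
move=> pm; have : coprime `|m|%N p by rewrite coprime_sym prime_coprime.
move/(v_nat_coprime p_prime KCp); case: m {pm} => n //=.
by rewrite NegzE mulrNz (vN vP).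
Qed.

Lemma v_int_dvd (m : int) : (p %| m)%Z -> v m%:~R < 1.
Proof.
move=> /dvdzP[k ->]; rewrite intrM mulrC (v_mulr_lt vP)//; last exact: (v_int_le1 vP).
exact: (v_p_lt1 p_prime KCp).
Qed.

(** The coefficients of a monic equation of y are replaced by nearby rationals, and the resulting
    polynomial by its primitive integral multiple. *)
Lemma Qpbar_int_relation y : Qpbar v y -> v y = 1 ->
  exists (c : nat -> int) n, (exists2 i, (i < n)%N & ~~ (p %| c i)%Z) /\
    v (\sum_(i < n) (c i)%:~R * y ^+ i) < 1.
Proof.
move=> [Q [Qm QQp Qy]] y1; have sQ : size Q = (size Q).-1.+1.
  by rewrite prednK// size_poly_gt0 monic_neq0.
set d := (size Q).-1 in sQ.
(* Precision 1 is the right one: powers of y have absolute value 1, so the value at y moves by less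
   than 1. The leading coefficient is kept equal to 1. *)
have /choice[q qP] : forall i, exists q : rat, v (ratr q - Q`_i) < 1.
  move=> i; have [u /(vcvgP vP)/(_ 1 ltr01)[N /(_ N (leqnn N))]] := QQp i.
  by exists (u N).
pose P := 'X^d + \poly_(i < d) q i.
have Pd : P`_d = 1 by rewrite coefD coefXn eqxx coef_poly ltnn addr0.
have Pgt i : (d < i)%N -> P`_i = 0.
  by move=> di; rewrite coefD coefXn coef_poly gtn_eqF// ltnNge ltnW//= addr0.
have Py : v (\sum_(i < d.+1) ratr P`_i * y ^+ i) < 1.
  rewrite -[X in v X]subr0 -[X in _ - X](rootP Qy) horner_coef sQ -sumrB (v_sum_lt vP)// => i _.
  rewrite -mulrBl (v_mulr_lt vP)//; last by rewrite (v_expr_le1 vP)// y1.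
  have := ltn_ord i; rewrite ltnS leq_eqVlt => /predU1P[->|id].
    move/monicP: Qm; rewrite lead_coefE Pd -/d => ->.
    by rewrite ratr_one subrr (v0 vP).
  by rewrite coefD coefXn ltn_eqF// add0r coef_poly id.
have [P0 [a a0 PE]] := rat_poly_scale P.
pose k := (a%:~R^-1 * (zcontents P0)%:~R : rat).
have PkE i : P`_i = k * ((zprimitive P0)`_i)%:~R.
  rewrite PE {1}(zpolyEprim P0) coefZ coef_map/= coefZ intrM /k; ring.
have P00 : P0 != 0.
  apply/eqP => P00; have := Pd; rewrite PE P00 rmorph0 scaler0 coef0.
  by move/esym/eqP; rewrite oner_eq0.
have [i0 pi0] : exists i0, ~~ (p %| (zprimitive P0)`_i0)%Z.
  apply: contrapT => /forallNP H; have : (p %| zcontents (zprimitive P0))%Z.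
    by rewrite dvdz_contents; apply/polyOverP => i; exact/negPn/negP.
  by rewrite zcontents_primitive P00 dvdz1 /= => /eqP p1; move: p_prime; rewrite p1.
have kE (i : nat) : ratr P`_i = ratr k * ((zprimitive P0)`_i)%:~R :> K.
  by rewrite PkE (ratr_mul p_prime KCp) ratr_int.
(* The leading coefficient 1 is [ratr k] times an integer; hence dividing by [ratr k] does not
   enlarge the value at y. *)
have vk : 1 <= v (ratr k).
  have := congr1 v (kE d); rewrite Pd ratr_one (v1 vP) vM => ->.
  by rewrite ler_piMr// (v_int_le1 vP).
exists (fun i => (zprimitive P0)`_i), d.+1; split.
  exists i0 => //; rewrite ltnNge; apply: contra pi0 => /Pgt; rewrite PkE => /eqP.
  rewrite mulf_eq0 => /orP[/eqP k0|]; last by rewrite intr_eq0 => /eqP ->; rewrite dvdz0.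
  by move: vk; rewrite k0 ratr_zero (v0 vP) ler10.
have -> : \sum_(i < d.+1) ((zprimitive P0)`_i)%:~R * y ^+ i =
    (ratr k)^-1 * \sum_(i < d.+1) ratr P`_i * y ^+ i.
  rewrite mulr_sumr; apply: eq_bigr => i _; rewrite kE -mulrA mulKf//.
  by rewrite -(v_gt0 vP) (lt_le_trans ltr01).
rewrite mulrC (v_mulr_lt vP)// (vV vP) invf_le1 ?(lt_le_trans ltr01)//.
Qed.

Lemma int_inverse_mod (m : int) : ~~ (p %| m)%Z ->
  exists k : int, v (k%:~R * m%:~R - 1) < 1.
Proof.
move=> pm; have : coprimez m p by rewrite coprimez_sym coprimezE prime_coprime.
move=> /coprimezP[[k l] /= kl]; exists k.
have -> : k%:~R * m%:~R - 1 = (- l * p)%:~R :> K.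
  have : (k * m + l * p)%:~R = 1 :> K by rewrite kl.
  rewrite intrD !intrM mulrNz => h.
  by rewrite -[X in _ - X]h; ring.
by apply: v_int_dvd; rewrite dvdz_mull.
Qed.

(** Top terms with coefficient divisible by p are dropped. The first remaining coefficient is
    invertible modulo p, and the relation is solved for its power of y. *)
Lemma power_relation y (c : nat -> int) n : v y = 1 ->
  (exists2 i, (i < n)%N & ~~ (p %| c i)%Z) ->
  v (\sum_(i < n) (c i)%:~R * y ^+ i) < 1 ->
  exists d (a : nat -> int), v (y ^+ d.+1 - \sum_(i < d.+1) (a i)%:~R * y ^+ i) < 1.
Proof.
move=> y1; elim: n => [[]//|n IH] [i0 i0n pci0]; rewrite big_ord_recr/=.
have yn1 m : v (y ^+ m) <= 1 by rewrite (v_expr_le1 vP)// y1.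
have [pcn|pcn] := boolP (p %| c n)%Z => h.
  apply: IH.
    exists i0 => //; rewrite ltn_neqAle -ltnS i0n andbT.
    by apply: contraNneq pci0 => ->.
  rewrite -[X in v X](addrK ((c n)%:~R * y ^+ n)) (vB_lt vP)//.
  by rewrite (v_mulr_lt vP)// v_int_dvd.
(* The surviving index is not 0, since a lone constant prime to p has absolute value 1. *)
case: n {IH i0n} pcn h => [|d] pcn h.
  by move: h; rewrite big_ord0 add0r expr0 mulr1 v_int_ndvd// ltxx.
have [k kP] := int_inverse_mod pcn.
exists d, (fun i => - (k * c i)).
have -> : y ^+ d.+1 - \sum_(i < d.+1) (- (k * c i))%:~R * y ^+ i =
   (\sum_(i < d.+1) (c i)%:~R * y ^+ i + (c d.+1)%:~R * y ^+ d.+1) * k%:~R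
   - (k%:~R * (c d.+1)%:~R - 1) * y ^+ d.+1.
  rewrite mulrDl mulr_suml mulrBl mul1r opprB addrCA -!addrA; congr (_ + _).
  rewrite (_ : _ * k%:~R - _ = 0) ?addr0; last by ring.
  rewrite -sumrN; apply: eq_bigr => i _; rewrite rmorphN rmorphM/=; ring.
rewrite (vB_lt vP)// (v_mulr_lt vP)//; exact: (v_int_le1 vP).
Qed.

(** The residues of all powers of y lie in the span of finitely many of them over the prime field, a
    finite set; this prepares the pigeonhole argument. *)
Lemma powers_mod y d (a : nat -> int) : v y = 1 ->
  v (y ^+ d.+1 - \sum_(i < d.+1) (a i)%:~R * y ^+ i) < 1 ->
  forall j, exists b : nat -> int, v (y ^+ j - \sum_(i < d.+1) (b i)%:~R * y ^+ i) < 1.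
Proof.
move=> y1 yd; elim=> [|j [b bP]].
  exists (fun i => (i == 0%N)%:Z); rewrite big_ord_recl big1 ?addr0 ?mul1r ?subrr ?(v0 vP)//.
  by move=> i _; rewrite mul0r.
exists (fun i => (if i is i'.+1 then b i' else 0) + b d * a i).
have -> : y ^+ j.+1 - \sum_(i < d.+1)
      ((if (i : nat) is i'.+1 then b i' else 0) + b d * a i)%:~R * y ^+ i =
    (y ^+ j - \sum_(i < d.+1) (b i)%:~R * y ^+ i) * y
    + (y ^+ d.+1 - \sum_(i < d.+1) (a i)%:~R * y ^+ i) * (b d)%:~R.
  have -> : \sum_(i < d.+1) ((if (i : nat) is i'.+1 then b i' else 0) + b d * a i)%:~R * y ^+ i
     = \sum_(i < d) (b i)%:~R * y ^+ i.+1 + (\sum_(i < d.+1) (a i)%:~R * y ^+ i) * (b d)%:~R.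
    under eq_bigr => i _ do rewrite intrD mulrDl.
    rewrite big_split/=; congr (_ + _).
      by rewrite big_ord_recl/= mul0r add0r.
    by rewrite mulr_suml; apply: eq_bigr => i _; rewrite intrM; ring.
  have -> : \sum_(i < d) (b i)%:~R * y ^+ i.+1 = (\sum_(i < d) (b i)%:~R * y ^+ i) * y.
    by rewrite mulr_suml; apply: eq_bigr => i _; rewrite exprSr mulrA.
  rewrite [\sum_(i < d.+1) (b i)%:~R * _]big_ord_recr/= !exprSr.
  ring.
by rewrite (vD_lt vP)// (v_mulr_lt vP)// ?y1// (v_int_le1 vP).
Qed.

(** In the expansion of (y + h)^p, every term other than y^p and h^p carries a binomial coefficient
    divisible by p and a factor h. *)
Lemma v_frob x y : v x <= 1 -> v y <= 1 ->
  v (x ^+ p - y ^+ p - (x - y) ^+ p) <= v p%:R * v (x - y).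
Proof.
move=> x1 y1; set h := x - y; have -> : x = y + h by rewrite /h addrC subrK.
have h1 : v h <= 1 by rewrite (vB_le vP).
rewrite exprDn; case: p p_prime => [//|[//|n]] pp.
rewrite big_ord_recl big_ord_recr/= !subn0 !subnn !expr0 !bin0 mulr1 mul1r.
rewrite binn !mulr1n; set s := \sum_(i < n.+1) _.
have -> : y ^+ n.+2 + (s + h ^+ n.+2) - y ^+ n.+2 - h ^+ n.+2 = s by ring.
rewrite (v_sum_le vP) ?mulr_ge0// => i _.
have /dvdnP[k ->] : (n.+2 %| 'C(n.+2, bump 0 i))%N.
  by apply: prime_dvd_bin => //; have := ltn_ord i; rewrite /bump/=; lia.
rewrite -mulr_natr natrM /= /bump/= add1n exprS.
have -> : y ^+ (n.+2 - i.+1) * (h * h ^+ i) * (k%:R * n.+2%:R) =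
  n.+2%:R * h * (h ^+ i * y ^+ (n.+2 - i.+1) * k%:R) by ring.
rewrite -vM (v_mulr_le vP)// (v_mulr_le vP) ?(v_nat_le1 vP)//.
by rewrite (v_mulr_le vP) ?(v_expr_le1 vP).
Qed.

(** Injectivity of the p-power map on residues: (x - y)^p differs from x^p - y^p by less than 1. *)
Lemma v_frob_lt1 x y : v x <= 1 -> v y <= 1 ->
  v (x ^+ p - y ^+ p) < 1 -> v (x - y) < 1.
Proof.
move=> x1 y1 xy; have h1 : v (x - y) <= 1 by rewrite (vB_le vP).
suff : v ((x - y) ^+ p) < 1 by rewrite (vX vP) expr_lt1 ?prime_gt0.
rewrite -[X in v X](subKr (x ^+ p - y ^+ p)) (vB_lt vP)//.
apply: (le_lt_trans (v_frob x1 y1)); rewrite -vM (v_mulr_lt vP)//.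
exact: (v_p_lt1 p_prime KCp).
Qed.

Lemma v_frob_iter_lt1 x y n : v x <= 1 -> v y <= 1 ->
  v (x ^+ (p ^ n) - y ^+ (p ^ n)) < 1 -> v (x - y) < 1.
Proof.
move=> x1 y1; elim: n => [|n IH]; first by rewrite expn0 !expr1.
rewrite expnSr !exprM => h; apply: IH; apply: v_frob_lt1 h; exact: (v_expr_le1 vP).
Qed.

Lemma v_frob_contract x y (c : R) : v x <= 1 -> v y <= 1 -> v (x - y) <= c -> v p%:R <= c ->
  v (x ^+ p - y ^+ p) <= c * v (x - y).
Proof.
move=> x1 y1 xyc pc; have h1 : v (x - y) <= 1 by rewrite (vB_le vP).
rewrite -[X in v X](subrK ((x - y) ^+ p)) (vD_le vP)//.
  by rewrite (le_trans (v_frob x1 y1))// ler_wpM2r.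
case: p p_prime => [//|[//|n]] _.
by rewrite exprS vM mulrC ler_wpM2r// exprS vM (le_trans _ xyc)// ler_piMr// (v_expr_le1 vP).
Qed.

Lemma v_frob_cvg x y (e : R) : v x <= 1 -> v y <= 1 -> v (x - y) < 1 -> 0 < e ->
  exists N, forall n, (N <= n)%N -> v (x ^+ (p ^ n) - y ^+ (p ^ n)) < e.
Proof.
(* c dominates both parts of x^p - y^p, the multiple of p and the p-th power of x - y. Distances
   only shrink, so the same contraction factor serves at every step. *)
move=> x1 y1 xy1 e0; pose c := Num.max (v (x - y)) (v p%:R).
have c1 : c < 1 by rewrite gt_max xy1 (v_p_lt1 p_prime KCp).
have c0 : 0 <= c by rewrite le_max v_ge0.
have H n : v (x ^+ (p ^ n) - y ^+ (p ^ n)) <= c ^+ n.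
  suff : v (x ^+ (p ^ n) - y ^+ (p ^ n)) <= c ^+ n * v (x - y).
    by move=> h; apply: (le_trans h); rewrite ler_piMr ?exprn_ge0// ltW.
  elim: n => [|n IH]; first by rewrite expn0 !expr1 mul1r.
  rewrite expnSr !exprM (le_trans (v_frob_contract (c := c) _ _ _ _))//.
  - exact: (v_expr_le1 vP).
  - exact: (v_expr_le1 vP).
  - rewrite (le_trans IH)// (@le_trans _ _ (v (x - y)))//; last by rewrite le_max lexx.
    by rewrite ler_piMl// exprn_ile1// ltW.
  - by rewrite le_max lexx orbT.
  - by rewrite exprS -mulrA ler_wpM2l.
have [|N NP] := @expr_lt_pos _ c e _ e0; first by rewrite c0.
by exists N => n /NP; exact: le_lt_trans.
Qed.

Lemma Qpbar_power_near1 y : Qpbar v y -> v y = 1 ->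
  exists m, [/\ (0 < m)%N, coprime m p & v (y ^+ m - 1) < 1].
Proof.
move=> yQ y1; have [c [n [cn csum]]] := Qpbar_int_relation yQ y1.
have [d [a yd]] := power_relation y1 cn csum.
have yn1 m : v (y ^+ m) = 1 by rewrite (vX vP) y1 expr1n.
have p0 := prime_gt0 p_prime.
(* Reducing the coefficients modulo p leaves finitely many combinations, so two distinct powers of y
   must share one. *)
have /choice[g gP] : forall j, exists b : {ffun 'I_d.+1 -> 'I_p},
    v (y ^+ j - \sum_(i < d.+1) (b i)%:R * y ^+ i) < 1.
  move=> j; have [b bP] := powers_mod y1 yd j.
  have ltp i : (`|(b i %% p)%Z|%N < p)%N.
    have : ((b i %% p)%Z < p)%R by rewrite ltz_pmod.
    by rewrite -(gez0_abs (modz_ge0 _ _)) ?ltz_nat//; lia.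
  exists [ffun i : 'I_d.+1 => Ordinal (ltp i)].
  apply: (v_trans_lt vP (y := \sum_(i < d.+1) (b i)%:~R * y ^+ i)) => //.
  rewrite -sumrB (v_sum_lt vP)// => i _; rewrite ffunE/= -mulrBl.
  rewrite (v_mulr_lt vP) ?yn1//.
  have -> : `|(b i %% p)%Z|%N%:R = (b i %% p)%Z%:~R :> K.
    by rewrite -[in RHS](gez0_abs (modz_ge0 _ _))//; lia.
  rewrite -rmorphB/= v_int_dvd//.
  by rewrite {1}(divz_eq (b i) p) addrK dvdz_mull.
have : ~~ injectiveb (fun j : 'I_(#|{ffun 'I_d.+1 -> 'I_p}|.+1) => g j).
  apply/injectiveP => /leq_card; rewrite card_ord => h.
  by have := leq_trans h (leqnn _); rewrite ltnn.
move=> /injectivePn[i [j ij gij]].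
wlog lij : i j ij gij / (i < j)%N.
  move=> H; case: (ltngtP i j) => h; first exact: (H i j).
    by apply: (H j i) => //; rewrite eq_sym.
  by move/eqP: ij; case; exact: val_inj.
have yij : v (y ^+ j - y ^+ i) < 1.
  apply: (v_trans_lt vP (gP j)); rewrite -gij (vBC vP); exact: gP.
pose m := (j - i)%N; have m0 : (0 < m)%N by rewrite subn_gt0.
have ym : v (y ^+ m - 1) < 1.
  move: yij; rewrite -(subnK (ltnW lij)) exprD -[X in _ - X]mul1r -mulrBl vM yn1 mulr1//.
(* The difference of exponents may be divisible by p; its p-part is removed by injectivity of the
   p-power map on residues. *)
have [m' cm' mE] := pfactor_coprime p_prime m0.
exists m'; split; first by move: m0; rewrite mE muln_gt0 => /andP[].
  by rewrite coprime_sym.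
apply: (v_frob_iter_lt1 (n := logn p m)); rewrite ?yn1 ?(v1 vP)//.
by rewrite expr1n -exprM -mE.
Qed.

(** This is [near_root] for X^m - 1, whose Weierstrass degree is m: the nearest root w satisfies |y
    - w|^m <= |y^m - 1| < 1. *)
Lemma unity_root_near y m : (0 < m)%N -> v y <= 1 -> v (y ^+ m - 1) < 1 ->
  exists2 w, w ^+ m = 1 & v (y - w) < 1.
Proof.
case: m => // m _ y1 ym; pose P : {poly K} := 'X^(m.+1) - 1.
have PE i : P`_i = (i == m.+1)%:R - (i == 0%N)%:R by rewrite coefB coefXn coef1.
have [|||w [w1 /rootP wr wy]] := @near_root _ _ _ _ p_prime KCp P m y.
- move=> i; rewrite PE; have -> : (i == m.+1)%:R - (i == 0%N)%:R =
    ((i == m.+1)%:Z - (i == 0%N)%:Z)%:~R :> K by rewrite rmorphB.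
  exact: (Qpbar_int p_prime KCp).
- split=> [i||i mi]; rewrite PE.
  + by rewrite (vB_le vP) ?(v_nat_le1 vP).
  + by rewrite eqxx subr0 (v1 vP).
  + by rewrite gtn_eqF// (gtn_eqF (leq_ltn_trans _ mi))// subrr (v0 vP).
- exact: y1.
have hE x : P.[x] = x ^+ m.+1 - 1 by rewrite hornerD hornerXn hornerN hornerC.
exists w; first by apply/eqP; rewrite -subr_eq0 -hE wr.
move: wy; rewrite hE => /le_lt_trans/(_ ym).
by rewrite expr_lt1.
Qed.

Lemma teichmuller_exists x : v x = 1 ->
  exists w : K, (exists2 m : nat, coprime m p & m.-primitive_root w) /\ v (x - w) < 1.
Proof.
move=> x1; have [y [yQ xy]] := Cp_Qpbar_dense KCp x ltr01.
have y1 : v y = 1.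
  by rewrite -x1; apply: (v_dom vP); rewrite (vBC vP) x1.
have [m [m0 mp ym]] := Qpbar_power_near1 yQ y1.
have [|w wm wy] := unity_root_near m0 _ ym; first by rewrite y1.
exists w; split; last exact: (v_trans_lt vP xy).
have [k wk km] := prim_order_exists m0 wm.
by exists k => //; exact: coprime_dvdl mp.
Qed.

Lemma omega_near x : v x <= 1 -> v (x - omega v p x) < 1.
Proof.
rewrite le_eqVlt /omega => /predU1P[x1|x1]; last by rewrite lt_eqF// subr0.
by rewrite x1 eqxx; have [] := xgetPex 0 (teichmuller_exists x1).
Qed.

(** For a root of unity of order m prime to p, Euler's theorem gives the period [totient m]; the
    value 0 is fixed by a single p-th power. *)
Lemma omega_frob x : exists2 l, (0 < l)%N & omega v p x ^+ (p ^ l) = omega v p x.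
Proof.
rewrite /omega; case: eqP => [x1|_]; last first.
  by exists 1%N => //; rewrite expr0n expn_eq0 (gtn_eqF (prime_gt0 p_prime)).
have [[m mp mw] _] := xgetPex 0 (teichmuller_exists x1).
set w := xget _ _ in mw *; have m0 := prim_order_gt0 mw.
exists (totient m); first by rewrite totient_gt0.
apply/eqP; rewrite -[X in _ == X]expr1 (eq_prim_root_expr mw).
by apply/eqP/cyclic.Euler_exp_totient; rewrite coprime_sym.
Qed.

Lemma v_omega_le1 x : v x <= 1 -> v (omega v p x) <= 1.
Proof.
move=> x1; rewrite -(vN vP) -(addKr x (- _)) (vD_le vP) ?(vN vP)//.
exact/ltW/omega_near.
Qed.

(** For a positive exponent, x is a root of the cyclotomic polynomial of the required order, a sum
    of p monomials. Its power y is not 1, because that sum would then equal p, which is nonzero in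
    K. *)
Lemma pprim_root_exists n : exists w : K, (p ^ n).-primitive_root w.
Proof.
have p0 := prime_gt0 p_prime; have p1 := prime_gt1 p_prime.
case: n => [|n].
  exists 1; have [m m1] := @prim_order_exists K 1 1 isT (expr1n _ _).
  by rewrite expn0 dvdn1 => /eqP m1'; rewrite m1' in m1.
have q0 : (0 < p ^ n)%N by rewrite expn_gt0 p0.
pose P : {poly K} := \sum_(i < p) 'X^(i * p ^ n).
have PE i : P`_i = (\sum_(j < p) (i == j * p ^ n)%N%:Z)%:~R.
  rewrite coef_sum rmorph_sum/=; apply: eq_bigr => j _.
  by rewrite coefXn.
have [||x [_ /rootP xr]] := Cp_Qpbar_closed KCp (P := P).
- by move=> i; rewrite PE; exact: (Qpbar_int p_prime KCp).
- rewrite ltnNge; apply/negP => sP.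
  have : P`_(p.-1 * p ^ n) = 0.
    by rewrite nth_default// (leq_trans sP)// muln_gt0 q0 andbT; lia.
  rewrite coef_sum (bigD1 (Ordinal (_ : p.-1 < p)%N)) ?prednK//= => ?.
  rewrite coefXn eqxx big1 ?addr0; first by move/eqP; rewrite oner_eq0.
  move=> i; rewrite -val_eqE/= => ip; rewrite coefXn eqn_pmul2r//.
  by rewrite eq_sym (negPf ip).
pose y := x ^+ (p ^ n).
have ys : \sum_(i < p) y ^+ i = 0.
  rewrite -[RHS]xr horner_sum; apply: eq_bigr => i _.
  by rewrite hornerXn /y -exprM mulnC.
have y1 : y != 1.
  apply/eqP => y1; move: ys; rewrite y1.
  under eq_bigr do rewrite expr1n.
  rewrite sumr_const card_ord => /eqP; apply/negP; exact: (p_neq0 p_prime KCp).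
have yp : y ^+ p = 1 by apply/eqP; rewrite -subr_eq0 subrX1 ys mulr0.
have xq : x ^+ (p ^ n.+1) = 1 by rewrite expnSr exprM.
exists x; have [|m mx mq] := prim_order_exists _ xq; first by rewrite expn_gt0 p0.
have /(dvdn_pfactor _ _ p_prime)[k kn mE] := mq.
move: kn; rewrite leq_eqVlt => /predU1P[kn|]; first by rewrite -kn -mE.
rewrite ltnS => kn; case/eqP: y1; rewrite /y.
by apply/eqP; rewrite -(prim_order_dvd mx) mE dvdn_exp2l.
Qed.

End RootsOfUnity.

(** * Sums over roots of unity *)

Lemma sum_prim_root (K : fieldType) q (w : K) j : q.-primitive_root w ->
  \sum_(i < q) (w ^+ i) ^+ j = if (q %| j)%N then q%:R else 0.
Proof.
move=> wq; have [qj|qj] := boolP (q %| j)%N.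
  under eq_bigr => i _ do
    rewrite -exprM mulnC exprM (eqP (_ : w ^+ j == 1)) ?expr1n -?(prim_order_dvd wq)//.
  by rewrite sumr_const card_ord.
have wj : w ^+ j - 1 != 0 by rewrite subr_eq0 -(prim_order_dvd wq).
apply: (mulfI wj); rewrite mulr0; under eq_bigr do rewrite -exprM mulnC exprM.
by rewrite -subrX1 -exprM mulnC exprM (prim_expr_order wq) expr1n subrr.
Qed.

(** For W = w^i one has W^q = 1, so W / (W - t) is (1 - t^q)^-1 times the sum of t^j W^(q - j) over
    j < q. Only j = 0 has an exponent divisible by q and survives the summation over i. *)
Lemma sum_arc_pole (K : fieldType) q (w t : K) : (0 < q)%N -> q%:R != 0 :> K -> q.-primitive_root w ->
  t ^+ q != 1 -> q%:R^-1 * (\sum_(i < q) w ^+ i / (w ^+ i - t)) = (1 - t ^+ q)^-1.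
Proof.
move=> q0 qK wq tq; have tq1 : 1 - t ^+ q != 0 by rewrite subr_eq0 eq_sym.
have wiq i : (w ^+ i) ^+ q = 1 by rewrite -exprM mulnC exprM (prim_expr_order wq) expr1n.
have E i : w ^+ i / (w ^+ i - t) = (1 - t ^+ q)^-1 *
    \sum_(j < q) t ^+ j * (w ^+ i) ^+ (q - j).
  have wit : w ^+ i - t != 0.
    by rewrite subr_eq0; apply: contraNneq tq => <-; rewrite wiq.
  apply: (mulfI wit); rewrite mulrCA divff// mulr1.
  apply: (mulfI tq1); rewrite mulrCA mulVKf//.
  rewrite -(wiq i) subrXX -mulrA; congr (_ * _); rewrite mulr_suml.
  apply: eq_bigr => j _; rewrite mulrAC mulrC -exprSr.
  by congr (_ * _ ^+ _); have := ltn_ord j; lia.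
under eq_bigr do rewrite E.
rewrite -mulr_sumr exchange_big/=.
under eq_bigr => j _ do rewrite -mulr_sumr (sum_prim_root _ wq).
case: q q0 qK wq tq tq1 {wiq E} => // q _ qK wq tq tq1.
rewrite big_ord_recl big1 ?addr0 ?subn0 ?dvdnn ?expr0 ?mul1r; last first.
  by move=> j _; rewrite gtnNdvd ?mulr0//= /bump; have := ltn_ord j; lia.
by rewrite mulrC mulfK.
Qed.

Lemma arc_sum_prim_root (K : fieldType) p (w a b : K) (f : K -> K) (phi : nat -> nat) k :
  (p ^ phi k).-primitive_root w ->
  arc_sum p a b f phi k = (p ^ phi k)%:R^-1 *
    \sum_(i < p ^ phi k) ((b - a) * w ^+ i) * f (a + (b - a) * w ^+ i).
Proof.
move=> wq; rewrite /arc_sum; set q := (p ^ phi k)%N in wq *.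
congr (_ * _); have q0 : (0 < q)%N := prim_order_gt0 wq.
pose s := [seq w ^+ i | i <- iota 0 q].
have us : uniq s.
  rewrite map_inj_in_uniq ?iota_uniq// => i j; rewrite !mem_iota !add0n /= => iq jq.
  by move/eqP; rewrite (eq_prim_root_expr wq) !modn_small// => /eqP.
have -> : [set zeta : K | q.-unity_root zeta] = [set` s].
  apply/seteqP; split=> x /=.
    rewrite unity_rootE => /eqP /(prim_rootP wq)[i ->].
    by apply/mapP; exists (i : nat) => //; rewrite mem_iota ltn_ord.
  case/mapP => i _ ->; rewrite unity_rootE -exprM mulnC exprM.
  by rewrite (prim_expr_order wq) expr1n.
rewrite -fsbig_seq// /s big_map -(subn0 q) -/(index_iota 0 q) big_mkord subn0.
by apply: eq_bigr => i _; rewrite addrAC subrr add0r.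
Qed.

Section ArcSums.
Context {R : realType} {K : fieldType} (v : K -> R) (p : nat).
Hypothesis p_prime : prime p.
Hypothesis KCp : is_Cp p v.
Implicit Types (x y z t w : K).

Let vP := Cp_absval KCp.
Let vC := Cp_complete KCp.
Let v_ge0 := absval_ge0 vP.
Let vM := absvalM vP.

Lemma v_unity_root_le1 q x : (0 < q)%N -> x ^+ q = 1 -> v x <= 1.
Proof.
move=> q0 xq; rewrite leNgt; apply/negP => x1.
have := congr1 v xq; rewrite (vX vP) (v1 vP) => /eqP.
by rewrite gt_eqF// exprn_egt1// -lt0n.
Qed.

Lemma vcvg_sum (I : Type) (r : seq I) (u : I -> nat -> K) l :
  (forall i, vcvg v (u i) (l i)) ->
  vcvg v (fun n => \sum_(i <- r) u i n) (\sum_(i <- r) l i).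
Proof.
move=> ul; elim: r => [|i r IH].
  rewrite big_nil; have := vcvg_cst vP 0; apply: eq_vcvg => n; by rewrite big_nil.
rewrite big_cons; have := vcvgD vP (ul i) IH; apply: eq_vcvg => n.
by rewrite big_cons.
Qed.

(** Orthogonality is applied to partial sums. The terms with q dividing m + 1 gain a factor q that
    cancels 1/q, the others vanish, and this divisibility forces m >= q - 1. *)
Lemma sum_arc_series q w (c : nat -> K) (B : R) : (0 < q)%N -> q%:R != 0 :> K ->
  q.-primitive_root w -> vnull v c -> 0 <= B ->
  (forall n, (q.-1 <= n)%N -> v (c n) <= B) ->
  v (q%:R^-1 * \sum_(i < q) w ^+ i * ev v c (w ^+ i)) <= B.
Proof.
move=> q0 qK wq c0 B0 cB.
have wi1 i : v (w ^+ i) <= 1.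
  by rewrite (v_expr_le1 vP)// (v_unity_root_le1 q0 (prim_expr_order wq)).
have h : vcvg v
    (fun n => q%:R^-1 * \sum_(i < q) w ^+ i * \sum_(m < n) c m * (w ^+ i) ^+ m)
    (q%:R^-1 * \sum_(i < q) w ^+ i * ev v c (w ^+ i)).
  apply: (vcvgMl vP); apply: vcvg_sum => i; apply: (vcvgMl vP).
  exact: (ev_cvg vP vC).
apply: (vcvg_le0 vP h) => n.
have -> : \sum_(i < q) w ^+ i * \sum_(m < n) c m * (w ^+ i) ^+ m =
    \sum_(m < n) c m * \sum_(i < q) (w ^+ i) ^+ m.+1.
  under eq_bigr do rewrite mulr_sumr.
  rewrite exchange_big/=; apply: eq_bigr => m _; rewrite mulr_sumr.
  by apply: eq_bigr => i _; rewrite mulrCA -exprS.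
rewrite mulr_sumr (v_sum_le vP)// => m _; rewrite (sum_prim_root _ wq).
case: ifP => [qm|_]; last by rewrite !mulr0 (v0 vP).
rewrite mulrCA mulVf// mulr1 cB//; have := dvdn_leq (ltn0Sn _) qm; lia.
Qed.

(* Along n = alpha + lambda k the powers t^(p^n) tend to w^(p^alpha), because
   w is fixed by the lambda-th power of Frobenius. *)
Lemma arc_pole_limit t w (al la : nat) (e : R) : (0 < la)%N ->
  v t <= 1 -> v w <= 1 -> v (t - w) < 1 -> 1 <= v (1 - t) ->
  w ^+ (p ^ la) = w -> 0 < e ->
  exists N, forall k, (N <= k)%N -> t ^+ (p ^ (al + la * k)) != 1 /\
    v ((1 - t ^+ (p ^ (al + la * k)))^-1 - (1 - w ^+ (p ^ al))^-1) < e.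
Proof.
move=> la0 t1 w1 tw t1' wla e0.
have wk k : w ^+ (p ^ (al + la * k)) = w ^+ (p ^ al).
  elim: k => [|k IH]; first by rewrite muln0 addn0.
  by rewrite mulnS addnCA expnD exprM wla.
(* Otherwise injectivity of the p-power map on residues would give |1 - w| < 1, and then |1 - t| <
   1. *)
have vw : v (1 - w ^+ (p ^ al)) = 1.
  apply/eqP; rewrite eq_le (vB_le vP) ?(v1 vP) ?(v_expr_le1 vP)//=.
  rewrite leNgt; apply/negP => h.
  have : v (1 - w) < 1.
    by apply: (v_frob_iter_lt1 p_prime KCp (n := al)); rewrite ?(v1 vP) ?expr1n.
  move=> h1; have : v (1 - t) < 1 by apply: (v_trans_lt vP h1); rewrite (vBC vP).
  by rewrite ltNge t1'.
(* The bound 1 transfers the absolute value of 1 - W to 1 - T; the bound e then passes to the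
   difference of the inverses. *)
have e1 : 0 < Num.min e 1 by rewrite lt_min e0 ltr01.
have [N NP] := v_frob_cvg p_prime KCp t1 w1 tw e1.
exists N => k Nk; have := NP (al + la * k)%N; rewrite wk lt_min.
move=> /(_ _)/andP[|h1 h2]; first by have := leq_pmull k la0; lia.
set T := t ^+ _ in h1 h2 *; set W := w ^+ _ in vw h1 h2 *.
have vT : v (1 - T) = 1.
  rewrite -vw; apply: (v_dom vP); rewrite vw opprB addrC addrA subrK (vBC vP)//.
have T1 : 1 - T != 0 by rewrite -(v_gt0 vP) vT.
have W1 : 1 - W != 0 by rewrite -(v_gt0 vP) vw.
split; first by move: T1; rewrite subr_eq0 eq_sym.
have -> : (1 - T)^-1 - (1 - W)^-1 = (T - W) * ((1 - T) * (1 - W))^-1.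
  by field; rewrite T1 W1.
by rewrite vM (vV vP) vM vT vw mulr1 invr1 mulr1.
Qed.

End ArcSums.

(** * Local expansions, orders and logarithmic derivatives *)

Section LocalExpansions.
Context {R : realType} {K : fieldType} (v : K -> R) (p : nat).
Hypothesis p_prime : prime p.
Hypothesis KCp : is_Cp p v.
Implicit Types (x y z e : K) (s t : nat -> K) (f g : K -> K).

Let vP := Cp_absval KCp.
Let vC := Cp_complete KCp.
Let v_ge0 := absval_ge0 vP.
Let vM := absvalM vP.

(** Powers of p. They show that punctured neighbourhoods are non-empty and replace real radii by
    absolute values of elements. *)
Lemma small_elt (d : R) : 0 < d -> exists h : K, [/\ h != 0, v h < d & v h < 1].
Proof.
move=> d0; have /(vnullP vP)/(_ d d0)[N NP] := vnull_expr vP (v_p_lt1 p_prime KCp).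
exists (p%:R ^+ N.+1); split; first by rewrite expf_neq0// (p_neq0 p_prime KCp).
  exact: NP.
by rewrite (vX vP) exprn_ilt1// (v_p_lt1 p_prime KCp).
Qed.

(** The radius is given by an element e, so that x = z + e * y moves the expansion to the closed
    unit disc; the coefficients s do not depend on this scale. *)
Definition expands_at e f z s :=
  [/\ e != 0, vnull v (fun i => s i * e ^+ i)
    & forall y, v y <= 1 -> f (z + e * y) = ev v (fun i => s i * e ^+ i) y].

Definition expands f z s := exists e, expands_at e f z s.

Lemma expands_at_shrink e e' f z s : e' != 0 -> v e' <= v e ->
  expands_at e f z s -> expands_at e' f z s.
Proof.
move=> e'0 e'e [e0 s0 fE].
have ve : v (e' / e) <= 1.
  by rewrite vM (vV vP) ler_pdivrMr ?(v_gt0 vP)// mul1r.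
have sE : (fun i => s i * e' ^+ i) = (fun i => s i * e ^+ i * (e' / e) ^+ i).
  by apply/funext => i; rewrite -mulrA -exprMn mulrCA divff// mulr1.
split=> //; rewrite sE; first exact: vnull_mulr.
move=> y y1; have yE : z + e' * y = z + e * (e' / e * y).
  by rewrite mulrA [e * _]mulrCA divff// mulr1.
rewrite yE fE; last by rewrite (v_mulr_le vP).
by congr tsum; apply/funext => i; rewrite exprMn mulrA.
Qed.

Lemma expands_small f z s (d : R) : 0 < d -> expands f z s ->
  exists2 e, v e < d & expands_at e f z s.
Proof.
move=> d0 [e fe]; have e0 : e != 0 by case: fe.
have ve0 : 0 < v e by rewrite (v_gt0 vP).
have [h [h0 hd h1]] := small_elt (divr_gt0 d0 ve0).
exists (e * h); first by rewrite vM mulrC -ltr_pdivlMr.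
apply: expands_at_shrink fe; first exact: mulf_neq0.
by rewrite (v_mulr_le vP)// ltW.
Qed.

Lemma expands_at0 f z s : expands f z s -> f z = s 0%N.
Proof.
move=> [e [e0 _ fE]].
by rewrite -(addr0 z) -(mulr0 e) fE ?(v0 vP)// ev_at0// mulr1.
Qed.

Lemma expands_cst (k : K) z : expands (fun=> k) z (fun i => k * sdelta i).
Proof.
have E : (fun i => k * sdelta i * 1 ^+ i) = (fun i => k * sdelta i : K).
  by apply/funext => i; rewrite expr1n mulr1.
have d0 : vnull v (@sdelta K).
  by apply: (vnull_finite vP (N := 1)) => -[].
exists 1; split; first exact: oner_neq0; rewrite E.
  exact: vnullMl.
move=> y y1; rewrite /ev -[LHS]mulr1 -(ev_sdelta vP y) /ev -(tsumMl vP vC).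
  by congr tsum; apply/funext => i; rewrite mulrA.
exact: vnull_mulr.
Qed.

Lemma expands_lin x z : expands (fun y => y - x) z (nth 0 [:: z - x; 1]).
Proof.
exists 1; split; first exact: oner_neq0.
  by apply: (vnull_finite vP (N := 2)) => -[|[|n]]//= _; rewrite nth_nil mul0r.
move=> y y1; rewrite /ev (@tsum_finite _ _ _ vP _ 2).
  by rewrite !big_ord_recl big_ord0/=; ring.
by move=> [|[|n]]//= _; rewrite nth_nil !mul0r.
Qed.

Lemma expands_mul f g z s t : expands f z s -> expands g z t ->
  expands (fun x => f x * g x) z (conv s t).
Proof.
move=> [e fe] [e' ge'].
have [d [fd gd]] : exists d, expands_at d f z s /\ expands_at d g z t.
  have [e0 _ _] := fe; have [e'0 _ _] := ge'.
  have [ee'|e'e] := leP (v e) (v e').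
    by exists e; split=> //; apply: expands_at_shrink ge'.
  by exists e'; split=> //; apply: expands_at_shrink fe => //; exact: ltW.
have [d0 s0 fE] := fd; have [_ t0 gE] := gd; exists d.
have E : (fun i => conv s t i * d ^+ i) =
    conv (fun i => s i * d ^+ i) (fun i => t i * d ^+ i).
  by apply/funext => i; rewrite conv_mulr.
split=> //; rewrite E; first exact: vnull_conv.
by move=> y y1; rewrite fE// gE// (ev_conv vP vC).
Qed.

Lemma expands_inv f z s : expands f z s -> s 0%N != 0 -> exists t,
  [/\ expands (fun x => (f x)^-1) z t, t 0%N = (s 0%N)^-1
    & t 1%N = - s 1%N * (s 0%N)^-2].
Proof.
move=> [e fe] s0; have [e0 sn fE] := fe.
have [B B0 sB] := vnull_bounded vP sn.
have vs0 : 0 < v (s 0%N) by rewrite (v_gt0 vP).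
(* With |h| * B < |s 0|, every rescaled coefficient of positive index is smaller than the constant
   term, so u is a unit series. *)
have [h [h0 hd h1]] := small_elt (divr_gt0 vs0 B0).
pose d := e * h; have d0 : d != 0 by rewrite mulf_neq0.
have [_ dn dE] : expands_at d f z s.
  by apply: expands_at_shrink fe => //; rewrite (v_mulr_le vP)// ltW.
pose u i := (s 0%N)^-1 * (s i * d ^+ i).
have uU : unit_series v u.
  split; [exact: vnullMl|by rewrite /u expr0 mulr1 mulVf|move=> i].
  rewrite vM (vV vP) mulrC ltr_pdivrMr// mul1r /d exprMn mulrA.
  rewrite [h ^+ _]exprS mulrA (v_mulr_lt vP)//; last by rewrite (v_expr_le1 vP)// ltW.
  rewrite vM mulrC; apply: (@le_lt_trans _ _ (v h * B)); first by rewrite ler_wpM2l.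
  by rewrite -ltr_pdivlMr.
have [un u01 _] := uU.
exists (fun i => (s 0%N)^-1 * sinv u i * d ^- i); split.
- have E : (fun i => (s 0%N)^-1 * sinv u i * d ^- i * d ^+ i) =
      (fun i => (s 0%N)^-1 * sinv u i).
    by apply/funext => i; rewrite divfK// expf_neq0.
  have iN := vnull_sinv vP uU; exists d; split=> //; rewrite E.
    exact: vnullMl.
  move=> y y1; rewrite dE//.
  have -> : ev v (fun i => (s 0%N)^-1 * sinv u i) y = (s 0%N)^-1 * ev v (sinv u) y.
    rewrite /ev -(tsumMl vP vC); last exact: vnull_mulr.
    by congr tsum; apply/funext => i; rewrite mulrA.
  have -> : ev v (fun i => s i * d ^+ i) y = s 0%N * ev v u y.
    rewrite /ev -(tsumMl vP vC); last exact: vnull_mulr.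
    by congr tsum; apply/funext => i; rewrite /u !mulrA mulfV// mul1r.
  have uy := ev_sinv vP vC uU y1; have uy0 := ev_unit_neq0 vP vC uU y1.
  by rewrite invfM; congr (_ * _); apply: (mulfI uy0); rewrite uy mulfV.
- by rewrite sinvE big_ord0 subr0 mulr1 expr0 invr1 mulr1.
- rewrite sinvE big_ord1/= sinvE big_ord0 subr0 mulr1 sub0r /u !expr1.
  by field; rewrite s0 d0.
Qed.

(** Re-expansion about an arbitrary point of the disc, needed because derivatives are taken on its
    boundary circle, away from the center a. *)
Lemma expands_ev (c : nat -> K) (a be z : K) : vnull v c -> be != 0 ->
  v ((z - a) / be) <= 1 ->
  let y0 := (z - a) / be in
  expands (fun x => ev v c ((x - a) / be)) z
    (fun j => ev v (iter j (sdiv v y0) c) y0 / be ^+ j).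
Proof.
move=> c0 be0 z1 y0; have p0 := p_neq0 p_prime KCp.
have p1 := v_p_lt1 p_prime KCp.
have [B B0 cB] := vnull_bounded vP c0.
have it j := iter_sdiv vP vC j c0 z1 cB.
(* The Taylor coefficients are only known to be bounded; shrinking the scale by the factor p turns
   them into a null sequence. *)
exists (be * p%:R).
have E : (fun j => ev v (iter j (sdiv v y0) c) y0 / be ^+ j * (be * p%:R) ^+ j) =
    (fun j => ev v (iter j (sdiv v y0) c) y0 * p%:R ^+ j).
  by apply/funext => j; rewrite exprMn mulrA divfK// expf_neq0.
have pn := vnull_expr vP p1.
have En : vnull v (fun j => ev v (iter j (sdiv v y0) c) y0 * p%:R ^+ j).
  apply: (@vnull_le _ _ _ vP _ _ B) pn => j; rewrite vM ler_wpM2r//.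
  by have [h1 h2] := it j; rewrite (ev_le vP vC).
split; rewrite ?E//; first exact: mulf_neq0.
move=> y y1; have -> : (z + be * p%:R * y - a) / be = y0 + p%:R * y.
  by rewrite /y0; field.
have py1 : v (p%:R * y) < 1 by rewrite (v_mulr_lt vP).
have yy1 : v (y0 + p%:R * y) <= 1 by rewrite (vD_le vP)// ltW.
apply: (vcvg_unique vP _ (ev_cvg vP vC En y1)).
have rem : vnull v (fun J => (p%:R * y) ^+ J * ev v (iter J (sdiv v y0) c) (y0 + p%:R * y)).
  apply: (@vnull_le _ _ _ vP _ _ B) (vnull_expr vP py1) => J.
  by have [h1 h2] := it J; rewrite vM mulrC ler_wpM2r// (ev_le vP vC).
have := vcvgB vP (vcvg_cst vP (ev v c (y0 + p%:R * y))) rem.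
rewrite subr0; apply: eq_vcvg => J.
rewrite (ev_taylor vP vC J c0 z1 yy1) [_ - (z - a) / be]addrAC subrr add0r addrK.
by apply: eq_bigr => j _; rewrite exprMn mulrA.
Qed.

Lemma expands_lipschitz f z s : expands f z s -> exists C d : R,
  [/\ 0 < C, 0 < d & forall x, v (x - z) <= d -> v (f x - s 0%N) <= C * v (x - z)].
Proof.
move=> [e [e0 sn fE]]; have [B B0 sB] := vnull_bounded vP sn.
have ve0 : 0 < v e by rewrite (v_gt0 vP).
exists (B / v e), (v e); split=> //; first exact: divr_gt0.
move=> x xz; have y1 : v ((x - z) / e) <= 1.
  by rewrite vM (vV vP) ler_pdivrMr// mul1r.
have -> : f x = ev v (fun i => s i * e ^+ i) ((x - z) / e).
  by rewrite -fE// mulrCA mulfV// mulr1 addrC subrK.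
have -> : B / v e * v (x - z) = v ((x - z) / e) * B by rewrite vM (vV vP); ring.
rewrite (ev_recl vP vC)// mulr1 addrAC subrr add0r vM ler_wpM2l//.
by rewrite (ev_le vP vC)//; exact: (proj2 (vnull_shift vP _) sn).
Qed.

(** * Limits and derivatives *)

Lemma tends_to_unique f z l m : tends_to v f z l -> tends_to v f z m -> l = m.
Proof.
move=> fl fm; apply/subr0_eq/(v_small_eq0 vP) => e e0.
have [d1 d10 d1P] := fl _ e0; have [d2 d20 d2P] := fm _ e0.
have d0 : 0 < Num.min d1 d2 by rewrite lt_min d10.
have [h [h0 hd _]] := small_elt d0; rewrite lt_min in hd.
have [hd1 hd2] := andP hd.
have zh : v (z + h - z) = v h by rewrite addrAC subrr add0r.
apply: (v_trans_le vP (y := f (z + h))).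
  by rewrite (vBC vP) ltW// d1P// zh (v_gt0 vP) h0.
by rewrite ltW// d2P// zh (v_gt0 vP) h0.
Qed.

Lemma tends_to_congr f g z l (d : R) : 0 < d ->
  (forall x, 0 < v (x - z) < d -> f x = g x) -> tends_to v g z l -> tends_to v f z l.
Proof.
move=> d0 fg gl e /gl[d1 d10 d1P]; exists (Num.min d d1).
  by rewrite lt_min d0.
by move=> x /andP[x0]; rewrite lt_min => /andP[xd xd1]; rewrite fg ?d1P ?x0.
Qed.

Lemma expands_tends_to f z s : expands f z s -> tends_to v f z (s 0%N).
Proof.
move=> /expands_lipschitz[C [d [C0 d0 fC]]] e e0.
exists (Num.min d (e / C)); first by rewrite lt_min d0 divr_gt0.
move=> x /andP[_]; rewrite lt_min => /andP[xd]; rewrite ltr_pdivlMr// mulrC.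
by apply: le_lt_trans; rewrite fC// ltW.
Qed.

Lemma expands_derive f z s : expands f z s ->
  tends_to v (fun y => (f y - f z) / (y - z)) z (s 1%N).
Proof.
move=> fz; have f0 := expands_at0 fz; move: fz => [e [e0 sn fE]].
have sn1 : vnull v (fun i => s i.+1 * e ^+ i.+1) := proj2 (vnull_shift vP _) sn.
have E : (fun i => s i.+1 * e ^+ i) = (fun i => e^-1 * (s i.+1 * e ^+ i.+1)).
  by apply/funext => i; rewrite exprS; field.
(* The difference quotient, completed by [s 1] at z, is given by the shifted series; its continuity
   at z yields the derivative. *)
pose g x := if x == z then s 1%N else (f x - f z) / (x - z).
have gz : expands g z (fun i => s i.+1).
  exists e; split=> //; rewrite E; first exact: vnullMl.
  move=> y y1; rewrite /ev.
  have -> : (fun i => e^-1 * (s i.+1 * e ^+ i.+1) * y ^+ i) =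
      (fun i => e^-1 * (s i.+1 * e ^+ i.+1 * y ^+ i)).
    by apply/funext => i; rewrite -!mulrA.
  rewrite (tsumMl vP vC); last exact: vnull_mulr.
  rewrite -/(ev v (fun i => s i.+1 * e ^+ i.+1) y) /g.
  have [->|y0] := eqVneq y 0.
    by rewrite mulr0 addr0 eqxx (ev_at0 vP) expr1 mulrC mulfK.
  rewrite -subr_eq0 addrAC subrr add0r mulf_eq0 (negPf e0) (negPf y0)/=.
  rewrite fE// (ev_recl vP vC)// mulr1 f0 addrAC subrr add0r.
  by field; rewrite e0 y0.
have := expands_tends_to gz; apply: (tends_to_congr ltr01) => x /andP[x0 _].
by rewrite /g; case: eqP x0 => // ->; rewrite subrr (v0 vP) ltxx.
Qed.

Lemma vderive_eq f x d :
  tends_to v (fun y => (f y - f x) / (y - x)) x d -> vderive v f x = d.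
Proof.
move=> h; rewrite /vderive; apply: xget_unique => // d' h'.
exact: tends_to_unique h' h.
Qed.

(* f is analytic and nonzero at z, with logarithmic derivative l there. *)
Definition logd f z l := exists s, [/\ expands f z s, s 0%N != 0 & s 1%N = l * s 0%N].

Lemma logd_mul f g z l m : logd f z l -> logd g z m ->
  logd (fun x => f x * g x) z (l + m).
Proof.
move=> [s [fs s0 s1]] [t [gt t0 t1]]; exists (conv s t); split.
- exact: expands_mul.
- by rewrite /conv big_ord1 mulf_neq0.
- by rewrite /conv !big_ord_recl !big_ord0/= s1 t1; ring.
Qed.

Lemma logd_inv f z l : logd f z l -> logd (fun x => (f x)^-1) z (- l).
Proof.
move=> [s [fs s0 s1]]; have [t [ft t0 t1]] := expands_inv fs s0.
exists t; split=> //; first by rewrite t0 invr_neq0.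
by rewrite t1 t0 s1; field.
Qed.

Lemma logd_cst (k : K) z : k != 0 -> logd (fun=> k) z 0.
Proof.
move=> k0; exists (fun i => k * sdelta i); split; first exact: expands_cst.
  by rewrite mulr1.
by rewrite mulr0 mul0r.
Qed.

Lemma logd_lin x z : z != x -> logd (fun y => y - x) z (z - x)^-1.
Proof.
move=> zx; exists (nth 0 [:: z - x; 1]); split; first exact: expands_lin.
  by rewrite subr_eq0.
by rewrite /= mulVf// subr_eq0.
Qed.

Lemma logd_prod (r : seq K) z : z \notin r ->
  logd (fun x => \prod_(y <- r) (x - y)) z (\sum_(y <- r) (z - y)^-1).
Proof.
elim: r => [_|y r IH].
  rewrite big_nil (_ : (fun _ => _) = (fun=> 1)); first exact/logd_cst/oner_neq0.
  by apply/funext => x; rewrite big_nil.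
rewrite inE negb_or => /andP[zy /IH zr]; rewrite big_cons.
rewrite (_ : (fun _ => _) = (fun x => (x - y) * \prod_(y <- r) (x - y))).
  exact: (logd_mul (logd_lin zy) zr).
by apply/funext => x; rewrite big_cons.
Qed.

Lemma logd_unit_series (u : nat -> K) (a be z : K) : unit_series v u -> be != 0 ->
  v ((z - a) / be) <= 1 ->
  logd (fun x => ev v u ((x - a) / be)) z
    (be^-1 * ev v (conv (sderiv u) (sinv u)) ((z - a) / be)).
Proof.
move=> uU be0 z1; have [u0 _ _] := uU; have := expands_ev u0 be0 z1.
set y0 := (z - a) / be => /= h; have uy := ev_unit_neq0 vP vC uU z1.
eexists; split; [exact: h|by rewrite /= expr0 divr1|].
rewrite /= expr0 expr1 divr1 (ev_sderiv vP vC)// (ev_conv vP vC)//.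
- by rewrite mulrC -!mulrA [X in _ * (_ * X)]mulrC (ev_sinv vP vC)// mulr1.
- exact: vnull_sderiv.
- exact: vnull_sinv.
Qed.

Lemma logd_vderive F f z l (d : R) : 0 < d -> logd F z l ->
  (forall x, v (x - z) < d -> f x = F x) -> vderive v f z / f z = l.
Proof.
move=> d0 [s [Fs s0 s1]] fF.
have fz : f z = F z by rewrite fF// subrr (v0 vP).
rewrite fz (vderive_eq (d := s 1%N)); last first.
  apply: (tends_to_congr d0) (expands_derive Fs) => x /andP[_ xd].
  by rewrite fz fF.
by rewrite (expands_at0 Fs) s1 mulfK.
Qed.

(** * From [HD] to local expansions and orders *)

Lemma HD_coef c (r : R) g e : HD v c r g -> e != 0 -> v e <= r ->
  exists2 s : nat -> K, vnull v s &
    forall x, v (x - c) <= v e -> g x = ev v s ((x - c) / e).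
Proof.
move=> [s sP] e0 er; pose s' i := s i * e ^+ i.
(* Convergence at the single point c + e forces the rescaled coefficients to tend to 0. *)
have sn : vnull v s'.
  have := sP (c + e); rewrite /cdisc/= addrAC subrr add0r => /(_ er).
  exact: vnull_terms.
exists s' => // x xe.
have y1 : v ((x - c) / e) <= 1.
  by rewrite vM (vV vP) ler_pdivrMr ?(v_gt0 vP)// mul1r.
apply: (vcvg_unique vP _ (ev_cvg vP vC sn y1)).
have := sP x (le_trans xe er); apply: eq_vcvg => n; apply: eq_bigr => i _.
by rewrite /s' -mulrA -exprMn mulrCA divff// mulr1.
Qed.

Lemma HD_expands c (r : R) g : 0 < r -> HD v c r g ->
  exists s, expands g c s.
Proof.
move=> r0 gH; have [h [h0 hr _]] := small_elt r0.
have [s sn gE] := HD_coef gH h0 (ltW hr).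
exists (fun i => s i / h ^+ i), h.
have E : (fun i => s i / h ^+ i * h ^+ i) = s.
  by apply/funext => i; rewrite divfK// expf_neq0.
split=> //; rewrite E// => y y1.
rewrite gE addrAC subrr add0r; first by rewrite mulrAC divff// mul1r.
by rewrite (v_mulr_le vP).
Qed.

Lemma logd_has_order U f z l (n : int) (d : R) : 0 < d -> logd U z l ->
  (forall x, 0 < v (x - z) < d -> f x = (x - z) ^ n * U x) -> has_order v f z n.
Proof.
move=> d0 [s [Us s0 _]] fU; have U0 := expands_at0 Us.
have [e ed [e0 sn UE]] := expands_small d0 Us.
exists U, (v e); split.
- by rewrite (v_gt0 vP).
- exists s => x xe; have y1 : v ((x - z) / e) <= 1.
    by rewrite vM (vV vP) ler_pdivrMr ?(v_gt0 vP)// mul1r.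
  have -> : U x = ev v (fun i => s i * e ^+ i) ((x - z) / e).
    by rewrite -UE// mulrCA mulfV// mulr1 addrC subrK.
  have := ev_cvg vP vC sn y1; apply: eq_vcvg => m; apply: eq_bigr => i _.
  by rewrite -mulrA -exprMn mulrCA divff// mulr1.
- by rewrite U0; apply/eqP.
- move=> x xe xz; rewrite fU// (v_gt0 vP) subr_eq0; apply/andP; split; first exact/eqP.
  exact: le_lt_trans xe ed.
Qed.

Lemma has_order_size f z (n : int) : has_order v f z n -> exists C d : R,
  [/\ 0 < C, 0 < d & forall x, 0 < v (x - z) < d -> v (f x) = v (x - z) ^ n * C].
Proof.
move=> [u [d [d0 uH u0 fu]]]; have [s us] := HD_expands d0 uH.
have s0 : 0 < v (s 0%N) by rewrite -(expands_at0 us) (v_gt0 vP); exact/eqP.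
have [d1 d10 d1P] := expands_tends_to us s0.
exists (v (s 0%N)), (Num.min d d1); split=> //; first by rewrite lt_min d0.
move=> x /andP[x0]; rewrite lt_min => /andP[xd xd1].
have xz : x <> z by move=> xz; rewrite xz subrr (v0 vP) ltxx in x0.
rewrite fu//; last exact: ltW.
rewrite vM; congr (_ * _); last by apply: (v_dom vP); rewrite d1P ?x0.
by case: n {fu} => n; rewrite ?NegzE -?exprnN -?exprnP ?(vV vP) (vX vP).
Qed.

(** Comparing the sizes of f at z + h and z + h * h eliminates the two constants and leaves |h|^n =
    |h|^m with 0 < |h| < 1. *)
Lemma has_order_unique f z (n m : int) : has_order v f z n -> has_order v f z m -> n = m.
Proof.
move=> /has_order_size[C [d [C0 d0 fC]]] /has_order_size[D [d' [D0 d'0 fD]]].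
have dd : 0 < Num.min d d' by rewrite lt_min d0.
have [h [h0 hd h1]] := small_elt dd.
have H y : v y <= 1 -> y != 0 -> v (h * y) ^ n * C = v (h * y) ^ m * D.
  move=> y1 y0; have := hd; rewrite lt_min => /andP[hd1 hd2].
  have hy : v (z + h * y - z) = v (h * y) by rewrite addrAC subrr add0r.
  have hy0 : 0 < v (h * y) by rewrite (v_gt0 vP) mulf_neq0.
  have hyd : v (h * y) <= v h by rewrite (v_mulr_le vP).
  have := fC (z + h * y); have := fD (z + h * y).
  rewrite hy hy0 (le_lt_trans hyd hd1) (le_lt_trans hyd hd2).
  by move=> /(_ isT) <- /(_ isT) <-.
have := H 1 _ (oner_neq0 _); rewrite mulr1 (v1 vP) => /(_ (lexx _)) H1.
have := H h (ltW h1) h0; rewrite vM !expfzMl.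
have vh : 0 < v h by rewrite (v_gt0 vP).
rewrite -!mulrA H1 => /(mulIf (_ : v h ^ m * D != 0)).
rewrite mulf_neq0 ?expfz_neq0 ?gt_eqF// => /(_ isT).
by apply: ieexprIz => //; rewrite lt_eqF.
Qed.

Lemma orderE f z (n : int) : has_order v f z n -> Defs.order v f z = n.
Proof.
move=> h; rewrite /Defs.order; apply: xget_unique => // m h'.
exact: has_order_unique h' h.
Qed.

End LocalExpansions.

(** * Factorization of meromorphic functions *)

(** For the zeros s of the numerator and t of the denominator with multiplicity, c is their common
    part; what remains can no longer cancel. *)
Lemma cancel_common (T : eqType) (s t : seq T) : exists c s' t' : seq T,
  [/\ perm_eq s (c ++ s'), perm_eq t (c ++ t') & forall x, x \in s' -> x \notin t'].
Proof.
elim: s t => [|x s IH] t; first by exists [::], [::], t.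
have [xt|xt] := boolP (x \in t).
  have [c [s' [t' [sE tE dj]]]] := IH (rem x t).
  exists (x :: c), s', t'; split=> //=; first by rewrite perm_cons.
  by rewrite (perm_trans (perm_to_rem xt))// perm_cons.
have [c [s' [t' [sE tE dj]]]] := IH t.
exists c, (x :: s'), t'; split=> //.
  by rewrite perm_sym -(cat1s x s') perm_catCA/= perm_cons perm_sym.
move=> y; rewrite inE => /predU1P[->|/dj//].
by apply: contra xt => xt'; rewrite (perm_mem tE) mem_cat xt' orbT.
Qed.

(** The summand is supported on the distinct entries of s, which reduces a sum over a possibly
    infinite disc to a count in a list. *)
Lemma fsbig_count (T : choiceType) (A : set T) (s : seq T) :
  (\big[addn/0%N]_(z \in A) count_mem z s = count (fun z => `[< A z >]) s)%N.
Proof.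
pose s1 := [seq z <- s | `[< A z >]].
have s1A z : z \in s1 -> A z by rewrite mem_filter => /andP[/asboolP].
rewrite (fsbigE (undup s1)).
- rewrite -size_filter -/s1 -(perm_size (perm_count_undup s1)) size_flatten.
  rewrite sumnE /shape -map_comp big_map big_mkcond [RHS]big_seq [LHS]big_seq.
  apply: eq_bigr => z; rewrite mem_undup => zs1; rewrite /= size_nseq.
  rewrite (mem_set (s1A _ zs1)) /s1 count_filter; apply: eq_count => y /=.
  by case: eqP => //= ->; symmetry; apply/asboolP/s1A.
- exact: undup_uniq.
- by move=> z; rewrite /= mem_undup => /s1A.
- move=> z Az; rewrite mem_undup mem_filter negb_and => /orP[/asboolP//|zs].
  by apply/count_memPn.
Qed.

Lemma prod_lin_eq0 (K : fieldType) (s : seq K) (x : K) :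
  (\prod_(y <- s) (x - y) == 0) = (x \in s).
Proof.
elim: s => [|y s IH]; first by rewrite big_nil oner_eq0.
by rewrite big_cons mulf_eq0 IH inE subr_eq0.
Qed.

Lemma prod_lin_split (K : fieldType) (s : seq K) (z x : K) :
  \prod_(y <- s) (x - y) =
  (x - z) ^+ count_mem z s * \prod_(y <- [seq y <- s | y != z]) (x - y).
Proof.
elim: s => [|y s IH]; first by rewrite !big_nil mulr1.
rewrite big_cons IH /=; case: eqP => [->|_]/=; first by rewrite exprS mulrA.
by rewrite add0n big_cons mulrCA.
Qed.

Section Meromorphic.
Context {R : realType} {K : fieldType} (v : K -> R) (p : nat).
Hypothesis p_prime : prime p.
Hypothesis KCp : is_Cp p v.
Context (a be : K).
Hypothesis be0 : be != 0.
Implicit Types (x y z k : K) (s t : seq K) (u : nat -> K) (f g h : K -> K).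

Let vP := Cp_absval KCp.
Let vC := Cp_complete KCp.
Let v_ge0 := absval_ge0 vP.
Let vM := absvalM vP.

Let coord x := (x - a) / be.

Lemma v_coord_le1 x : (v ((x - a) / be) <= 1) = (v (x - a) <= v be).
Proof. by rewrite vM (vV vP) ler_pdivrMr ?(v_gt0 vP)// mul1r. Qed.

Lemma HD_factor g : HD v a (v be) g -> (exists2 x, v (x - a) <= v be & g x <> 0) ->
  exists k s u, [/\ k != 0, unit_series v u, (forall y, y \in s -> v (y - a) <= v be)
    & forall x, v (x - a) <= v be ->
        g x = k * \prod_(y <- s) (x - y) * ev v u (coord x)].
Proof.
move=> gH [x0 x0D gx0]; have [c cn gE] := HD_coef KCp gH be0 (lexx _).
have [|k [s [u [k0 uU s1 cE]]]] := weierstrass_nonzero p_prime KCp cn.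
  apply: contrapT => /forallNP c0; apply: gx0; rewrite gE//.
  rewrite /ev (@tsum_finite _ _ _ vP _ 0) ?big_ord0// => n _.
  by have /contrapT -> := c0 n; rewrite mul0r.
(* Passing from the coordinate (x - a) / be to x costs a factor 1 / be for each root, absorbed in
   the constant. *)
exists (k * \prod_(y <- s) be^-1), [seq a + be * y | y <- s], u; split=> //.
- by rewrite mulf_neq0// prodf_seq_neq0; apply/allP => y _; rewrite invr_neq0.
- move=> _ /mapP[y /s1 y1 ->]; rewrite addrAC subrr add0r.
  by rewrite (v_mulr_le vP).
- move=> x xD; rewrite gE// cE ?v_coord_le1// big_map -!mulrA; congr (_ * _).
  rewrite mulrA -big_split/=; congr (_ * _); apply: eq_bigr => y _.
  by rewrite opprD addrA mulrBr mulKf// mulrC.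
Qed.

Lemma punctured_avoid s z : exists2 d : R, 0 < d &
  forall x, 0 < v (x - z) < d -> x \notin s.
Proof.
elim: s => [|y s [d d0 dP]]; first by exists 1.
have [->|yz] := eqVneq y z.
  exists d => // x xd; rewrite inE negb_or dP// andbT.
  by case/andP: xd; rewrite (v_gt0 vP) subr_eq0.
exists (Num.min d (v (y - z))); first by rewrite lt_min d0 (v_gt0 vP) subr_eq0.
move=> x /andP[x0]; rewrite lt_min => /andP[xd xy].
rewrite inE negb_or dP ?x0// andbT; apply: contraTneq xy => ->.
by rewrite ltxx.
Qed.

Definition quot_form k s t u1 u2 x :=
  k * (\prod_(y <- s) (x - y) * (\prod_(y <- t) (x - y))^-1 *
       (ev v u1 (coord x) * (ev v u2 (coord x))^-1)).

(* conv (sderiv u) (sinv u) is the series u'/u. *)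
Definition quot_logd s t u1 u2 z :=
  \sum_(y <- s) (z - y)^-1 - \sum_(y <- t) (z - y)^-1
  + (be^-1 * ev v (conv (sderiv u1) (sinv u1)) (coord z)
     - be^-1 * ev v (conv (sderiv u2) (sinv u2)) (coord z)).

Lemma logd_quot_form k s t u1 u2 z : k != 0 -> unit_series v u1 -> unit_series v u2 ->
  v (z - a) <= v be -> z \notin s -> z \notin t ->
  logd v (quot_form k s t u1 u2) z (quot_logd s t u1 u2 z).
Proof.
move=> k0 u1U u2U zD zs zt; rewrite -v_coord_le1 in zD.
rewrite -[quot_logd _ _ _ _ _]add0r.
apply: (logd_mul KCp); first exact: (logd_cst KCp).
apply: (logd_mul KCp); apply: (logd_mul KCp).
- exact: (logd_prod KCp).
- by apply: (logd_inv p_prime KCp); exact: (logd_prod KCp).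
- exact: (logd_unit_series p_prime KCp).
- by apply: (logd_inv p_prime KCp); exact: (logd_unit_series p_prime KCp).
Qed.

Lemma quot_form_split k s t u1 u2 z x : x != z ->
  quot_form k s t u1 u2 x =
  (x - z) ^ ((count_mem z s)%:Z - (count_mem z t)%:Z) *
  quot_form k [seq y <- s | y != z] [seq y <- t | y != z] u1 u2 x.
Proof.
move=> xz; have xz0 : x - z != 0 by rewrite subr_eq0.
rewrite expfzDr// -exprnN -exprnP /quot_form (prod_lin_split s z) (prod_lin_split t z).
by rewrite invfM; ring.
Qed.

Lemma quot_form_tends_to k s t u1 u2 z : k != 0 -> unit_series v u1 -> unit_series v u2 ->
  v (z - a) <= v be -> z \notin t ->
  tends_to v (quot_form k s t u1 u2) z (quot_form k s t u1 u2 z).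
Proof.
move=> k0 u1U u2U zD zt.
(* The factors from s may vanish at z, where no logarithmic derivative exists; they are set aside
   here and expanded separately. *)
have [l [w [wE _ _]]] : exists l, logd v (quot_form k [::] t u1 u2) z l.
  by eexists; apply: logd_quot_form.
have [c hs] : exists c, expands v (fun x => \prod_(y <- s) (x - y)) z c.
  elim: s => [|y s [c hs]].
    rewrite (_ : (fun _ => _) = (fun=> 1)); first by eexists; exact: (expands_cst KCp).
    by apply/funext => x; rewrite big_nil.
  eexists; rewrite (_ : (fun _ => _) = (fun x => (x - y) * \prod_(y <- s) (x - y))).
    by apply: (expands_mul KCp) hs; exact: (expands_lin KCp).
  by apply/funext => x; rewrite big_cons.
have := expands_mul KCp hs wE.
rewrite [X in expands v X](_ : _ = quot_form k s t u1 u2).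
  by move=> H; rewrite (expands_at0 KCp H); exact: (expands_tends_to KCp).
by apply/funext => x; rewrite /quot_form big_nil; ring.
Qed.

(** Equality with [quot_form] is demanded on punctured neighbourhoods only: f is arbitrary at its
    poles, and the quotient g / h says nothing at common zeros. The last clause recovers the other
    values. *)
Definition local_form f k s t u1 u2 :=
  [/\ k != 0, unit_series v u1, unit_series v u2,
      forall y, y \in s ++ t -> v (y - a) <= v be
    & forall y, y \in s -> y \notin t] /\
  (forall z, v (z - a) <= v be -> exists2 d : R, 0 < d &
     forall x, 0 < v (x - z) < d -> f x = quot_form k s t u1 u2 x) /\
  (forall x l, v (x - a) <= v be -> tends_to v f x l -> f x = l).

Lemma near_in_disc z x : v (z - a) <= v be -> v (x - z) < v be -> v (x - a) <= v be.
Proof. by move=> zD xz; apply: (v_trans_le vP) zD; exact: ltW. Qed.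

Lemma meromorphic_local_form f g h : HD v a (v be) g -> HD v a (v be) h ->
  (exists2 x, v (x - a) <= v be & g x <> 0) ->
  (exists2 x, v (x - a) <= v be & h x <> 0) ->
  (forall x, v (x - a) <= v be -> h x <> 0 -> f x = g x / h x) ->
  (forall x l, v (x - a) <= v be -> tends_to v f x l -> f x = l) ->
  exists k s t u1 u2, local_form f k s t u1 u2.
Proof.
move=> gH hH g0 h0 fgh fl.
have [k1 [s1 [u1 [k10 u1U s1D gE]]]] := HD_factor gH g0.
have [k2 [s2 [u2 [k20 u2U s2D hE]]]] := HD_factor hH h0.
have [c [s [t [sE tE dj]]]] := cancel_common s1 s2.
exists (k1 / k2), s, t, u1, u2; split; [split=> //|split=> //].
- by rewrite mulf_neq0// invr_neq0.
- move=> y; rewrite mem_cat => /orP[ys|yt].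
    by apply: s1D; rewrite (perm_mem sE) mem_cat ys orbT.
  by apply: s2D; rewrite (perm_mem tE) mem_cat yt orbT.
move=> z zD; have [d d0 dP] := punctured_avoid s2 z.
exists (Num.min d (v be)); first by rewrite lt_min d0 (v_gt0 vP).
move=> x /andP[x0]; rewrite lt_min => /andP[xd xbe].
have xD := near_in_disc zD xbe.
have xs2 : x \notin s2 by rewrite dP// x0.
have u2x : ev v u2 (coord x) != 0 by rewrite (ev_unit_neq0 vP vC u2U)// v_coord_le1.
have hx : h x != 0 by rewrite hE// !mulf_neq0// prod_lin_eq0.
rewrite fgh//; last exact/eqP.
rewrite gE// hE// (perm_big _ sE) (perm_big _ tE)/= !big_cat/= /quot_form.
have xc : \prod_(y <- c) (x - y) != 0.
  by rewrite prod_lin_eq0; apply: contra xs2; rewrite (perm_mem tE) mem_cat => ->.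
have xt : \prod_(y <- t) (x - y) != 0.
  by rewrite prod_lin_eq0; apply: contra xs2; rewrite (perm_mem tE) mem_cat orbC => ->.
by field; rewrite k20 u2x xc xt.
Qed.

Section LocalForm.
Context (f : K -> K) (k : K) (s t : seq K) (u1 u2 : nat -> K).
Hypothesis fF : local_form f k s t u1 u2.

Lemma local_form_val z : v (z - a) <= v be -> z \notin t ->
  f z = quot_form k s t u1 u2 z.
Proof.
move: fF => [[k0 u1U u2U _ _] [fz fl]] zD zt; apply: fl => //.
have [d d0 dP] := fz z zD; apply: (tends_to_congr d0 dP).
exact: quot_form_tends_to.
Qed.

(** After the powers of x - z are split off, neither list contains z, so [logd_quot_form] provides
    an analytic nonvanishing cofactor. *)
Lemma local_form_order z : v (z - a) <= v be ->
  has_order v f z ((count_mem z s)%:Z - (count_mem z t)%:Z).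
Proof.
move: fF => [[k0 u1U u2U _ _] [fz fl]] zD.
have [d d0 dP] := fz z zD.
apply: (logd_has_order p_prime KCp d0
  (logd_quot_form k0 u1U u2U zD (s := [seq y <- s | y != z])
     (t := [seq y <- t | y != z]) _ _)); rewrite ?mem_filter ?eqxx//.
move=> x xd; rewrite dP//; apply: quot_form_split.
by case/andP: xd; rewrite (v_gt0 vP) subr_eq0.
Qed.

(** The lists s and t are disjoint, so at most one of the two counts is nonzero and their difference
    determines both. *)
Lemma local_form_mult z : v (z - a) <= v be ->
  zero_mult v f z = count_mem z s /\ pole_mult v f z = count_mem z t.
Proof.
move=> zD; have := orderE p_prime KCp (local_form_order zD).
rewrite /zero_mult /pole_mult => ->.
move: fF => [[_ _ _ _ dj] _].
have [zs|zs] := boolP (z \in s).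
  by rewrite (count_memPn (dj _ zs)) subr0.
by rewrite (count_memPn zs) sub0r; case: (count_mem z t) => [|n].
Qed.

Lemma local_form_zero_pole y : y \in s ++ t -> is_zero v f y \/ is_pole v f y.
Proof.
move: fF => [[_ _ _ D dj] _] yst; have yD := D _ yst.
have yo := local_form_order yD.
move: yst; rewrite mem_cat => /orP[ys|yt].
  left; have yt := dj _ ys; split; last first.
    rewrite local_form_val// /quot_form (eqP (_ : \prod_(y0 <- s) (y - y0) == 0)).
      by rewrite !mul0r mulr0.
    by rewrite prod_lin_eq0.
  move=> [n n0 nf]; have := has_order_unique p_prime KCp nf yo.
  by rewrite (count_memPn yt) subr0 => nE; rewrite nE in n0.
right; exists ((count_mem y s)%:Z - (count_mem y t)%:Z) => //.
have ys : y \notin s by apply: contraTN yt => /dj.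
by rewrite (count_memPn ys) sub0r oppr_lt0 ltz_nat -has_count has_pred1.
Qed.

Lemma local_form_logd z : v (z - a) <= v be -> z \notin s -> z \notin t ->
  vderive v f z / f z = quot_logd s t u1 u2 z.
Proof.
move: (fF) => [[k0 u1U u2U _ _] [fz _]] zD zs zt; have [d d0 dP] := fz z zD.
apply: (logd_vderive p_prime KCp d0 (logd_quot_form k0 u1U u2U zD zs zt)).
move=> x xd; have [->|xz] := eqVneq x z; first exact: local_form_val.
by apply: dP; rewrite xd (v_gt0 vP) subr_eq0 xz.
Qed.

End LocalForm.

End Meromorphic.

(** * The arc integral *)

Section ArcIntegral.
Context {R : realType} {K : fieldType} (v : K -> R) (p : nat).
Hypothesis p_prime : prime p.
Hypothesis KCp : is_Cp p v.
Implicit Types (x y z w : K) (s t : seq K) (u : nat -> K) (L : K -> K).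

Let vP := Cp_absval KCp.
Let v_ge0 := absval_ge0 vP.

Lemma natq_neq0 n : (p ^ n)%:R != 0 :> K.
Proof. by rewrite natrX expf_neq0// (p_neq0 p_prime KCp). Qed.

Definition arc_pole (a be : K) n y := (1 - ((y - a) / be) ^+ (p ^ n))^-1.

Lemma arc_sum_poles (a be : K) n w s : be != 0 -> (p ^ n).-primitive_root w ->
  (forall y, y \in s -> ((y - a) / be) ^+ (p ^ n) != 1) ->
  (p ^ n)%:R^-1 * (\sum_(i < p ^ n) (be * w ^+ i) *
      \sum_(y <- s) (a + be * w ^+ i - y)^-1) = \sum_(y <- s) arc_pole a be n y.
Proof.
move=> be0 wq s1; under eq_bigr do rewrite mulr_sumr.
rewrite exchange_big/= mulr_sumr; apply: eq_big_seq => y ys.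
rewrite /arc_pole -(sum_arc_pole (prim_order_gt0 wq) (natq_neq0 n) wq (s1 y ys)).
congr (_ * _); apply: eq_bigr => i _.
have -> : a + be * w ^+ i - y = be * (w ^+ i - (y - a) / be) by field.
by rewrite invfM mulrACA divff// mul1r.
Qed.

Lemma arc_sum_quot_logd (a be : K) n w s t u1 u2 f :
  be != 0 -> (p ^ n).-primitive_root w ->
  (forall y, y \in s ++ t -> ((y - a) / be) ^+ (p ^ n) != 1) ->
  (forall i : nat, f (a + be * w ^+ i) = quot_logd v a be s t u1 u2 (a + be * w ^+ i)) ->
  (p ^ n)%:R^-1 * (\sum_(i < p ^ n) (be * w ^+ i) * f (a + be * w ^+ i)) =
  \sum_(y <- s) arc_pole a be n y - \sum_(y <- t) arc_pole a be n y
  + ((p ^ n)%:R^-1 * (\sum_(i < p ^ n)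
        w ^+ i * ev v (conv (sderiv u1) (sinv u1)) (w ^+ i))
     - (p ^ n)%:R^-1 * (\sum_(i < p ^ n)
        w ^+ i * ev v (conv (sderiv u2) (sinv u2)) (w ^+ i))).
Proof.
move=> be0 wq st1 fE.
rewrite -(arc_sum_poles be0 wq); last by move=> y ys; rewrite st1// mem_cat ys.
rewrite -(arc_sum_poles be0 wq); last by move=> y ys; rewrite st1// mem_cat ys orbT.
rewrite -!mulrBr -!sumrB -mulrDr -big_split/=; congr (_ * _).
apply: eq_bigr => i _; rewrite fE /quot_logd.
have -> : (a + be * w ^+ i - a) / be = w ^+ i by field.
rewrite mulrDr mulrBr; congr (_ + _).
by rewrite -mulrBr mulrACA divff// mul1r mulrBr.
Qed.

Lemma finite_eventually (I : eqType) (r : seq I) (P : I -> nat -> Prop) :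
  (forall i, i \in r -> exists N, forall k, (N <= k)%N -> P i k) ->
  exists N, forall k, (N <= k)%N -> forall i, i \in r -> P i k.
Proof.
elim: r => [|i r IH] H; first by exists 0%N.
have [|N1 N1P] := IH; first by move=> j jr; apply: H; rewrite inE jr orbT.
have [N2 N2P] := H i (mem_head _ _).
exists (N1 + N2)%N => k Nk j; rewrite inE => /predU1P[->|jr].
  by apply: N2P; lia.
by apply: N1P => //; lia.
Qed.

Lemma arc_series_limit u (al la : nat) (e : R) : (0 < la)%N -> unit_series v u -> 0 < e ->
  exists N, forall k, (N <= k)%N -> forall w, (p ^ (al + la * k)).-primitive_root w ->
    v ((p ^ (al + la * k))%:R^-1 * (\sum_(i < p ^ (al + la * k))
        w ^+ i * ev v (conv (sderiv u) (sinv u)) (w ^+ i))) < e.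
Proof.
move=> la0 uU e0; have [u0 _ _] := uU.
have Wn : vnull v (conv (sderiv u) (sinv u)).
  by apply: (vnull_conv vP); [exact: (vnull_sderiv vP)|exact: (vnull_sinv vP uU)].
have /(vnullP vP)/(_ (e / 2))[|N NP] := Wn; first by rewrite divr_gt0.
exists N => k Nk w wq; apply: (@le_lt_trans _ _ (e / 2)); last lra.
apply: (sum_arc_series p_prime KCp) => //.
- exact: prim_order_gt0 wq.
- exact: natq_neq0.
- by rewrite divr_ge0// ltW.
- move=> n qn; rewrite ltW// NP//.
  (* The surviving indices are at least p^(al + la k) - 1 >= al + la k >= k >= N. *)
  have h1 : (k <= al + la * k)%N by have := leq_pmull k la0; lia.
  have := ltn_expl (al + la * k) (prime_gt1 p_prime); lia.
Qed.

(** [L y] stands for the limit contributed by a zero or pole y; the Teichmuller representatives w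
    may vary with y, but [la] must be a period of all of them. *)
Lemma local_form_arc_limit (a b : K) f k0 s t u1 u2 L (al la : nat) (e : R) :
  b - a != 0 -> local_form v a (b - a) f k0 s t u1 u2 -> (0 < la)%N ->
  (forall y, y \in s ++ t -> exists w, [/\ v w <= 1, v ((y - a) / (b - a) - w) < 1,
     1 <= v (1 - (y - a) / (b - a)), w ^+ (p ^ la) = w & L y = (1 - w ^+ (p ^ al))^-1]) ->
  0 < e ->
  exists N, forall (phi : nat -> nat) k, (N <= k)%N -> phi k = (al + la * k)%N ->
    v (arc_sum p a b (fun x => vderive v f x / f x) phi k
       - (\sum_(y <- s) L y - \sum_(y <- t) L y)) < e.
Proof.
move=> be0 fF la0 HL e0; set be := b - a in be0 fF HL *.
have [[_ u1U u2U D _] _] := fF.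
have [y|N1 N1P] := @finite_eventually _ (s ++ t) (fun y k =>
    ((y - a) / be) ^+ (p ^ (al + la * k)) != 1 /\
    v (arc_pole a be (al + la * k) y - L y) < e).
  move=> yst; have [w [w1 yw y1 wla ->]] := HL y yst.
  apply: (arc_pole_limit p_prime KCp al la0) => //.
  by rewrite (v_coord_le1 KCp a be0) D.
have [N2 N2P] := arc_series_limit al la0 u1U e0.
have [N3 N3P] := arc_series_limit al la0 u2U e0.
exists (N1 + N2 + N3)%N => phi k Nk phik.
have [w] := pprim_root_exists p_prime KCp (phi k) => wq.
set G := (fun x => vderive v f x / f x); rewrite (arc_sum_prim_root _ _ _ wq) -/be.
rewrite phik in wq *; set n := (al + la * k)%N in wq *.
have st1 y : y \in s ++ t -> ((y - a) / be) ^+ (p ^ n) != 1.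
  by move=> /(N1P k _)[|//]; lia.
have st2 y : y \in s ++ t -> v (arc_pole a be n y - L y) < e.
  by move=> /(N1P k _)[|//]; lia.
have wi i : (w ^+ i) ^+ (p ^ n) = 1.
  by rewrite -exprM mulnC exprM (prim_expr_order wq) expr1n.
have vwi i : v (w ^+ i) <= 1.
  exact: (v_unity_root_le1 KCp (prim_order_gt0 wq) (wi i)).
rewrite (arc_sum_quot_logd (s := s) (t := t) (u1 := u1) (u2 := u2)) //; last first.
  (* The coordinate of a sample point is w^i, whose p^n-th power is 1, while [st1] excludes this for
     zeros and poles. *)
  move=> i; have nst : a + be * w ^+ i \notin s ++ t.
    apply/negP => /st1; rewrite (_ : (a + be * w ^+ i - a) / be = w ^+ i).
      by rewrite wi eqxx.
    by field.
  move: nst; rewrite mem_cat negb_or => /andP[ns nt].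
  apply: (local_form_logd p_prime KCp be0 fF) => //.
  by rewrite addrAC subrr add0r (v_mulr_le vP).
set A1 := _ * \sum_(i < _) _ * ev v (conv (sderiv u1) _) _.
set A2 := _ * \sum_(i < _) _ * ev v (conv (sderiv u2) _) _.
have E (x1 x2 x3 x4 x5 : K) :
  x1 - x2 + x5 - (x3 - x4) = (x1 - x3) - (x2 - x4) + x5 by ring.
rewrite E -!sumrB.
rewrite (vD_lt vP)//; last by rewrite (vB_lt vP)// (N2P, N3P)//; lia.
rewrite (vB_lt vP)// big_seq (v_sum_lt vP)// => y yst; apply: st2;
  by rewrite mem_cat yst ?orbT.
Qed.

End ArcIntegral.

(** * Assembling the contributions of the discs *)

Lemma frob_fixed_mul (K : fieldType) (w : K) (p l m : nat) :
  w ^+ (p ^ l) = w -> w ^+ (p ^ (l * m)) = w.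
Proof.
move=> wl; elim: m => [|m IH]; first by rewrite muln0 expn0 expr1.
by rewrite mulnS expnD exprM wl.
Qed.

Lemma Phi_eltE (alpha la : nat) (la0 : (0 < la)%N) k :
  (ps_start (Phi_elt alpha%:Z la0) <= k)%N ->
  Phi_elt alpha%:Z la0 k = (alpha + la * k)%N.
Proof.
move=> /Phi_eltP h; apply/eqP; rewrite -eqz_nat; apply/eqP.
by rewrite h.
Qed.

(** A weight per disc times a count becomes a weight per zero or pole, the shape in which the limit
    is computed. *)
Lemma sum_over_cells (K : fieldType) (T : eqType) (M : nat) (A : 'I_M -> set T)
  (G : 'I_M -> K) (s : seq T) :
  \sum_(i < M) G i * (count (fun y => `[< A i y >]) s)%:R =
  \sum_(y <- s) \sum_(i < M | `[< A i y >]) G i.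
Proof.
rewrite [RHS](eq_bigr (fun y => \sum_(i < M) G i * (`[< A i y >])%:R)); last first.
  move=> y _; rewrite big_mkcond; apply: eq_bigr => i _.
  by case: `[< _ >]; rewrite ?mulr1 ?mulr0.
rewrite exchange_big/=; apply: eq_bigr => i _.
rewrite -mulr_sumr -natr_sum -sum1_count big_mkcond; congr (_ * _%:R).
Qed.

Theorem theorem4p8 (R : realType) (p : nat) (K : fieldType) (v : K -> R)
  (p_prime : prime p) (p_odd : odd p) (K_Cp : is_Cp p v)
  (a b : K) (r : R) (r_gt0 : 0 < r)
  (f : K -> K) (f_mero : meromorphic_on v a r f)
  (M : nat) (z : 'I_M -> K)
  (D_distinct : injective (fun i => odisc v (z i) r))
  (zeros_poles_in : forall x, cdisc v a r x -> is_zero v f x \/ is_pole v f x ->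
     exists i, odisc v (z i) r x)
  (b_circle : v (b - a) = r)
  (b_notin : forall i, ~ odisc v (z i) r b)
  (alpha : nat) :
  let Z i := num_zeros v f (cdisc v a r `&` odisc v (z i) r) in
  let P i := num_poles v f (cdisc v a r `&` odisc v (z i) r) in
  is_arc_integral v p a b (Phi alpha%:Z) (fun x => vderive v f x / f x)
    (\sum_(i < M)
       1 / (1 - omega v p ((a - z i) / (a - b)) ^+ (p ^ alpha))
       * ((Z i)%:R - (P i)%:R)).
Proof.
move=> Z P; have vP := Cp_absval K_Cp.
have be0 : b - a != 0 by rewrite -(v_gt0 vP) b_circle.
have ab0 : a - b != 0 by rewrite -opprB oppr_eq0.
rewrite -b_circle in r_gt0 f_mero D_distinct zeros_poles_in b_notin Z P *.
set be := b - a in be0 r_gt0 f_mero D_distinct zeros_poles_in b_notin Z P *.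
move: f_mero => [g [h [gH hH h0 fgh fl]]].
have bD : v (b - a) <= v be by [].
(* If g vanished on D, so would f near b and, by the clause on removable singularities, at b. Then b
   is a zero and not a pole, since |f| is positive near a pole, and b would lie in some D_i. *)
have g0 : exists2 x, v (x - a) <= v be & g x <> 0.
  apply: contrapT => /forall2NP g0.
  have {}g0 x : v (x - a) <= v be -> g x = 0.
    by move=> xD; have [] := g0 x => // /contrapT.
  have [k [s [u [k0 uU _ hE]]]] := HD_factor p_prime K_Cp be0 hH h0.
  have [d d0 dP] := punctured_avoid K_Cp s b.
  have f0 x : 0 < v (x - b) < Num.min d (v be) -> f x = 0.
    move=> /andP[x0]; rewrite lt_min => /andP[xd xbe].
    have xD := near_in_disc K_Cp bD xbe.
    rewrite fgh ?g0 ?mul0r//; apply/eqP; rewrite hE// !mulf_neq0//.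
      by rewrite prod_lin_eq0 dP// x0.
    by rewrite (ev_unit_neq0 vP (Cp_complete K_Cp) uU)// (v_coord_le1 K_Cp _ be0).
  have m0 : 0 < Num.min d (v be) by rewrite lt_min d0.
  have fb : f b = 0.
    apply: fl => //; apply: (tends_to_congr m0 f0) => e e0.
    by exists 1 => // x _; rewrite subrr (v0 vP).
  have [|i bi] := zeros_poles_in b bD; last exact: (b_notin i bi).
  left; split=> // -[n _ /(has_order_size p_prime K_Cp)[C [d' [C0 d'0 fC]]]].
  have mm0 : 0 < Num.min (Num.min d (v be)) d' by rewrite lt_min m0.
  have [w [w0 wm _]] := small_elt p_prime K_Cp mm0.
  rewrite lt_min in wm; have [wd wd'] := andP wm.
  have bw : v (b + w - b) = v w by rewrite addrAC subrr add0r.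
  have vw : 0 < v w by rewrite (v_gt0 vP).
  have := fC (b + w); rewrite f0 bw ?vw ?wd// wd' (v0 vP) => /(_ isT) /esym/eqP.
  by rewrite gt_eqF// mulr_gt0// exprz_gt0.
have [k0 [s [t [u1 [u2 fF]]]]] :=
  meromorphic_local_form p_prime K_Cp be0 gH hH g0 h0 fgh fl.
have [[_ _ _ D dj] _] := fF.
pose A i y := v (y - z i) < v be.
pose G i := (1 - omega v p ((a - z i) / (a - b)) ^+ (p ^ alpha))^-1.
(* For a disc that meets D the argument of [omega] has absolute value at most 1, away from the
   default value; the other discs have both counts equal to 0. *)
have AD i y : A i y -> v (y - a) <= v be -> v ((a - z i) / (a - b)) <= 1.
  move=> Aiy yD; rewrite (absvalM vP) (vV vP) -(vN vP (a - b)) opprB.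
  rewrite ler_pdivrMr// mul1r (v_trans_le vP (y := y))//; last exact: ltW.
  by rewrite (vBC vP).
(* Two discs of equal radius with a common point coincide, so [D_distinct] makes the disc around y
   unique. *)
have cell y : y \in s ++ t -> exists2 i, A i y & forall j, A j y -> j = i.
  move=> yst; have [i Ai] := zeros_poles_in y (D y yst)
    (local_form_zero_pole p_prime K_Cp be0 fF yst).
  exists i => // j Aj; apply: D_distinct; apply/seteqP; split=> x xA.
    apply: (v_trans_lt vP xA); apply: (v_trans_lt vP (y := y)) => //.
    by rewrite (vBC vP).
  apply: (v_trans_lt vP xA); apply: (v_trans_lt vP (y := y)) => //.
  by rewrite (vBC vP).
have ZE i : Z i = count (fun y => `[< A i y >]) s.
  rewrite /Z /num_zeros (eq_fsbigr (fun y => count_mem y s)); last first.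
    move=> y; rewrite inE => -[yD _].
    by have [] := local_form_mult p_prime K_Cp be0 fF yD.
  rewrite fsbig_count; apply: eq_in_count => y ys; apply/asboolP/asboolP; first by case.
  by move=> Ay; split=> //; apply: D; rewrite mem_cat ys.
have PE i : P i = count (fun y => `[< A i y >]) t.
  rewrite /P /num_poles (eq_fsbigr (fun y => count_mem y t)); last first.
    move=> y; rewrite inE => -[yD _].
    by have [] := local_form_mult p_prime K_Cp be0 fF yD.
  rewrite fsbig_count; apply: eq_in_count => y yt; apply/asboolP/asboolP; first by case.
  by move=> Ay; split=> //; apply: D; rewrite mem_cat yt orbT.
(* For y in s or t exactly one index contributes, by [cell]. *)
pose L y := \sum_(i < M | `[< A i y >]) G i.
have -> : \sum_(i < M) 1 / (1 - omega v p ((a - z i) / (a - b)) ^+ (p ^ alpha)) *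
    ((Z i)%:R - (P i)%:R) = \sum_(y <- s) L y - \sum_(y <- t) L y.
  rewrite -!sum_over_cells -sumrB; apply: eq_bigr => i _.
  by rewrite ZE PE -mulrBr div1r.
have /choice[l lP] : forall i, exists l, (0 < l)%N /\
    omega v p ((a - z i) / (a - b)) ^+ (p ^ l) = omega v p ((a - z i) / (a - b)).
  by move=> i; have [l l0 lE] := omega_frob p_prime K_Cp ((a - z i) / (a - b)); exists l.
(* A common multiple of the periods, so one path sequence fixes all the Teichmuller
   representatives. *)
pose la := (\prod_(i < M) l i)%N.
have la0 : (0 < la)%N by rewrite prodn_gt0// => i; have [] := lP i.
move=> e e0; exists (Phi_elt alpha%:Z la0); split.
  by exists la => // k; exact: Phi_eltP.
have [|N NP] := @local_form_arc_limit _ _ v p p_prime K_Cp a b f k0 s t u1 u2 L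
  alpha la e be0 fF la0 _ e0.
  move=> y yst; have [i Ai iu] := cell y yst.
  have yD := D y yst; have zi1 := AD i y Ai yD.
  exists (omega v p ((a - z i) / (a - b))); split.
  - exact: (v_omega_le1 p_prime K_Cp).
  - apply: (v_trans_lt vP (y := (a - z i) / (a - b))); last exact: omega_near.
    (* Both quotients are coordinates with respect to a and b: numerator and denominator of the
       second are reversed together. *)
    have -> : (y - a) / be - (a - z i) / (a - b) = (y - z i) / be.
      by rewrite /be; field; rewrite be0 ab0.
    by rewrite (absvalM vP) (vV vP) ltr_pdivrMr// mul1r.
  (* This is where the position of b outside D_i enters: y lies in D_i, so |b - y| < r would put b
     in D_i as well. *)
  - have -> : 1 - (y - a) / be = (b - y) / be by rewrite /be; field.
    rewrite (absvalM vP) (vV vP) ler_pdivlMr// mul1r leNgt; apply/negP => yb.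
    by apply: (b_notin i); exact: (v_trans_lt vP yb).
  - rewrite /la (bigD1 i)//= frob_fixed_mul//; by have [] := lP i.
  - rewrite /L (bigD1 i)/=; last exact/asboolP.
    rewrite big1 ?addr0// => j /andP[/asboolP/iu ->].
    by rewrite eqxx.
exists N => k kstart Nk; apply: NP; first exact: ltnW.
exact: Phi_eltE.
Qed.
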